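(* For every $m\in[1,4)$, the space $\mathcal H_0^1(\Omega)$ is compactly embedded in $L^m(\Omega)$.
   Context: Let $\alpha_1,\alpha_2\in(0,\frac12)$ and $\Omega=\{(x,y)\in\mathbb R^2: 0<x<1,\ 0<y<1\}$. $\mathcal H^1(\Omega)=\{u\in L^2(\Omega): y^{\alpha_1}\partial_xu\in L^2(\Omega),\ x^{\alpha_2}\partial_yu\in L^2(\Omega)\}$ (distributional derivatives), with norm $\|u\|_{\mathcal H^1(\Omega)}=\left(\|u\|_{L^2}^2+\|y^{\alpha_1}\partial_xu\|_{L^2}^2+\|x^{\alpha_2}\partial_yu\|_{L^2}^2\right)^{1/2}$; $\mathcal H_0^1(\Omega)$ is the closure of $C_0^\infty(\Omega)$ in $\mathcal H^1(\Omega)$. *)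

(* Defs.v *)
From HB Require Import structures.
From mathcomp Require Import all_boot all_order all_algebra.
From mathcomp Require Import all_classical all_reals all_analysis.
Set Implicit Arguments.
Unset Strict Implicit.
Unset Printing Implicit Defensive.
Import Order.TTheory GRing.Theory Num.Theory.
Import numFieldNormedType.Exports.
Local Open Scope classical_set_scope.
Local Open Scope ring_scope.

Definition Omega (R : realType) : set (R * R) := `]0, 1[ `*` `]0, 1[.

Lemma measurable_Omega (R : realType) : measurable (@Omega R).
Proof. exact: measurableX. Qed.

(* Functions on Omega are represented by total functions on R * R; only their
   values in Omega matter, since muO vanishes on the complement of Omega. *)
Definition muO (R : realType) :
    {measure set (measurableTypeR R * measurableTypeR R) -> \bar R} :=
  mrestr (@lebesgue_measure R \x @lebesgue_measure R)%E
         (@measurable_Omega R).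

(* Only meaningful for f in L^2(Omega), since fine +oo = 0. *)
Definition L2norm (R : realType) (f : R * R -> R) : R :=
  fine ('N[muO R]_(2%:E)[EFin \o f])%E.

Definition e1 (R : realType) : R * R := (1, 0).
Definition e2 (R : realType) : R * R := (0, 1).

Fixpoint Ck (R : realType) (k : nat) (f : R * R -> R) : Prop :=
  match k with
  | 0 => continuous f
  | k'.+1 =>
      [/\ continuous f,
          (forall p, derivable f p (e1 R)) /\ (forall p, derivable f p (e2 R)),
          Ck k' (fun p => 'D_(e1 R) f p)
        & Ck k' (fun p => 'D_(e2 R) f p)]
  end.

(* The space C_0^oo(Omega); its elements are extended by 0 to the plane. *)
Definition test_function (R : realType) (phi : R * R -> R) : Prop :=
  [/\ forall k, Ck k phi,
      compact (closure [set p | phi p != 0])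
    & closure [set p | phi p != 0] `<=` @Omega R].

(* w . (d u / d v) = g in the sense of distributions on Omega, where w is a
   weight that is smooth in Omega (possibly not up to its boundary):
   < w d_v u, phi > = < d_v u, w phi > = - < u, d_v (w phi) >. *)
Definition weighted_weak_derivative (R : realType) (w : R * R -> R)
    (v : R * R) (u g : R * R -> R) : Prop :=
  forall phi : R * R -> R, test_function phi ->
    - (\int[muO R]_p (u p * 'D_v (fun q => w q * phi q) p)) =
    (\int[muO R]_p (g p * phi p)).

Definition weight_y (R : realType) (a1 : R) (p : R * R) : R := p.2 `^ a1.
Definition weight_x (R : realType) (a2 : R) (p : R * R) : R := p.1 `^ a2.

(* An element of H^1(Omega) is given by representatives of u, y^a1 d_x u and
   x^a2 d_y u. The last two are determined by u up to equality a.e. in Omega,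
   hence so are all the norms below. *)
Record H1 (R : realType) (a1 a2 : R) := MkH1 {
  H1fun :> R * R -> R ;
  wdx : R * R -> R ;
  wdy : R * R -> R ;
  H1fun_L2 : H1fun \in Lfun (muO R) 2%:E ;
  wdx_L2 : wdx \in Lfun (muO R) 2%:E ;
  wdy_L2 : wdy \in Lfun (muO R) 2%:E ;
  wdxP : weighted_weak_derivative (weight_y a1) (e1 R) H1fun wdx ;
  wdyP : weighted_weak_derivative (weight_x a2) (e2 R) H1fun wdy
}.

Definition graph_norm (R : realType) (f gx gy : R * R -> R) : R :=
  Num.sqrt (L2norm f ^+ 2 + L2norm gx ^+ 2 + L2norm gy ^+ 2).

Definition H1norm (R : realType) (a1 a2 : R) (u : H1 a1 a2) : R :=
  graph_norm u (wdx u) (wdy u).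

(* The H^1(Omega) norm of u - phi, for a test function phi (whose
   distributional derivatives are the classical ones). *)
Definition H1dist_test (R : realType) (a1 a2 : R) (u : H1 a1 a2)
    (phi : R * R -> R) : R :=
  graph_norm (fun p => u p - phi p)
    (fun p => wdx u p - weight_y a1 p * 'D_(e1 R) phi p)
    (fun p => wdy u p - weight_x a2 p * 'D_(e2 R) phi p).

Definition H10 (R : realType) (a1 a2 : R) : set (H1 a1 a2) :=
  [set u | forall eps : R, 0 < eps ->
     exists2 phi, test_function phi & H1dist_test u phi < eps].

(* Compactness is expressed sequentially: bounded sequences of X have
   subsequences converging in L^m(Omega). *)
Definition compactly_embedded_in_Lm (R : realType) (a1 a2 : R)
    (X : set (H1 a1 a2)) (m : R) : Prop :=
  [/\ forall u, X u -> (u : R * R -> R) \in Lfun (muO R) m%:E,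
      exists C : R, forall u, X u ->
        ('N[muO R]_(m%:E)[EFin \o u] <= (C * H1norm u)%:E)%E
    & forall u_ : nat -> H1 a1 a2,
        (forall n, X (u_ n)) ->
        (exists M : R, forall n, H1norm (u_ n) <= M) ->
        exists (s : nat -> nat) (l : R * R -> R),
          [/\ {homo s : i j / (i < j)%N},
              l \in Lfun (muO R) m%:E
            & 'N[muO R]_(m%:E)[EFin \o (fun p => (u_ (s n) p - l p)%R)]%E
                @[n --> \oo] --> 0%E]].

(* Main.v *)
Require Import Defs.
From mathcomp Require Import all_boot all_order all_algebra.
From mathcomp Require Import all_classical all_reals all_analysis.
From mathcomp Require Import measurable_realfun ring lra.
Import Order.TTheory GRing.Theory Num.Theory.
Import numFieldNormedType.Exports.
Set Implicit Arguments.
Unset Strict Implicit.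
Unset Printing Implicit Defensive.
Local Open Scope classical_set_scope.
Local Open Scope ring_scope.

(** The theorem rests on two estimates for a test function phi with partial
    derivatives D1 and D2, and on a way to pass to limits.

    The first estimate is a bound in L^4.  Let A(y) be the integral over x of
    (y^a1 D1)^2, and B(x) the integral over y of (x^a2 D2)^2.  Since phi
    vanishes on the sides of the square, the Cauchy-Schwarz inequality on a
    horizontal segment gives y^(2 a1) phi(x, y)^2 <= x A(y), and on a vertical
    segment x^(2 a2) phi(x, y)^2 <= y B(x).  Because 2 a1 and 2 a2 are at most
    1, the two weights are at least y and x on the square, so the product of
    both lines reads phi(x, y)^4 <= A(y) B(x).  The variables are separated,
    and integrating gives [integral_expr4_le_energy].

    The second estimate is an L^1 bound of the gradient: |D1| is at most
    y^(- 2 a1) + (y^a1 D1)^2, and y^(- 2 a1) is integrable on (0, 1) since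
    2 a1 < 1 ([L1_derivative_bound1], [L1_derivative_bound2]).  Cut the square
    into N^2 equal cells.  By a Poincare inequality, the L^1 norm of phi is at
    most 1/N times the L^1 norm of its gradient plus the sum over the cells of
    |integral of phi| ([L1_le_grid]).  Hence, along a bounded sequence, the L^1
    distance of two terms is controlled, up to an error of order 1/N, by
    finitely many bounded numerical sequences.  These all converge along an
    ultrafilter on nat, so the sequence is Cauchy in L^1 along that
    ultrafilter ([H10_ultra_cauchy]), and a subsequence whose successive L^1
    distances are at most 2^-(k+1) can be extracted ([rapid_cauchy_subseq]).
    Such a subsequence converges almost everywhere ([ae_cvg_rapid_cauchy]).

    Elements of the closure of the test functions are reached by almost
    everywhere limits, through which Fatou's lemma carries the L^4 bound
    ([integral_expr4_H10_le]).  Finally, the exponent m lies between 1 and 4: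
    for every t > 0, |v|^m <= t^(m-1) |v| + t^(m-4) v^4
    ([powR_interpolation]).  As m < 4, a large t makes the last term uniformly
    small on bounded sets of L^4, and convergence in L^1 then takes care of the
    first one ([Lm_le_of_L1_small]). *)

(** * Inequalities between integrals *)

Section integral_inequalities.
Context d (T : measurableType d) (R : realType) (mu : {measure set T -> \bar R}).

Lemma measurable_EFinX (f : T -> R) (n : nat) :
  measurable_fun setT f -> measurable_fun setT (fun p => (f p ^+ n)%:E).
Proof. by move=> mf; apply/measurable_EFinP; exact: measurable_funX. Qed.

Lemma integral_normB_le (f g : T -> R) :
  measurable_fun setT f -> measurable_fun setT g ->
  (\int[mu]_p `|f p - g p|%:E <=
   \int[mu]_p `|f p|%:E + \int[mu]_p `|g p|%:E)%E.
Proof.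
move=> mf mg; rewrite -ge0_integralD//.
- apply: ge0_le_integral => //.
  + apply/measurable_EFinP; apply: measurableT_comp => //; exact: measurable_funB.
  + by apply: emeasurable_funD; apply/measurable_EFinP; exact: measurableT_comp.
  + by move=> p _; rewrite -EFinD lee_fin ler_normB.
- by apply/measurable_EFinP; exact: measurableT_comp.
- by apply/measurable_EFinP; exact: measurableT_comp.
Qed.

Lemma integral_normB_le3 (f g h k : T -> R) :
  measurable_fun setT f -> measurable_fun setT g ->
  measurable_fun setT h -> measurable_fun setT k ->
  (\int[mu]_p `|f p - k p|%:E <= \int[mu]_p `|f p - g p|%:E +
    \int[mu]_p `|g p - h p|%:E + \int[mu]_p `|k p - h p|%:E)%E.
Proof.
move=> mf mg mh mk.
have mB (a b : T -> R) : measurable_fun setT a ->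
    measurable_fun setT b ->
    measurable_fun setT (fun p => `|a p - b p|%:E).
  move=> ma mb; apply/measurable_EFinP; apply: measurableT_comp => //.
  exact: measurable_funB.
have B0 (a b : T -> R) p : (0 <= `|a p - b p|%:E)%E by rewrite lee_fin.
rewrite -(ge0_integralD mu measurableT (fun p _ => B0 f g p) (mB _ _ mf mg)
  (fun p _ => B0 g h p) (mB _ _ mg mh)).
rewrite -(ge0_integralD mu measurableT (fun p _ => adde_ge0 (B0 f g p) (B0 g h p))
  (emeasurable_funD (mB _ _ mf mg) (mB _ _ mg mh)) (fun p _ => B0 k h p) (mB _ _ mk mh)).
apply: ge0_le_integral => //.
- exact: mB.
- apply: emeasurable_funD; [apply: emeasurable_funD|]; exact: mB.
- move=> p _; rewrite -!EFinD lee_fin (distrC (k p)).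
  have -> : f p - k p = (f p - g p) + (g p - h p) + (h p - k p) by ring.
  by apply: le_trans (ler_normD _ _) _; rewrite lerD2r; exact: ler_normD.
Qed.

(** This is 8 (a^4 + b^4) - (a - b)^4 = 6 (a^2 - b^2)^2 + (a + b)^4 >= 0,
    integrated.  With 4-th powers of bounds, 8 (t^4 + t^4) = (2 t)^4. *)
Lemma integral_expr4B_le (f g : T -> R) (t : R) :
  measurable_fun setT f -> measurable_fun setT g ->
  (\int[mu]_p (f p ^+ 4)%:E <= (t ^+ 4)%:E)%E ->
  (\int[mu]_p (g p ^+ 4)%:E <= (t ^+ 4)%:E)%E ->
  (\int[mu]_p ((f p - g p) ^+ 4)%:E <= ((2 * t) ^+ 4)%:E)%E.
Proof.
move=> mf mg ft gt'.
have m4 (a : T -> R) : measurable_fun setT a ->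
   measurable_fun setT (fun p => (a p ^+ 4)%:E) by exact: measurable_EFinX.
have a40 (a : T -> R) p : (0 <= (a p ^+ 4)%:E)%E by rewrite lee_fin exprn_even_ge0.
have e80 : (0 <= 8%:E :> \bar R)%E by rewrite lee_fin.
apply: (@le_trans _ _ (\int[mu]_p (8%:E * ((f p ^+ 4)%:E + (g p ^+ 4)%:E)))%E).
  apply: ge0_le_integral => //.
  - by move=> p _; rewrite lee_fin exprn_even_ge0.
  - exact: (m4 (fun p => f p - g p) (measurable_funB mf mg)).
  - by apply: measurable_funeM; apply: emeasurable_funD; exact: m4.
  - move=> p _; rewrite -EFinD -EFinM lee_fin.
    rewrite -subr_ge0 (_ : _ - _ = 6 * (f p ^+ 2 - g p ^+ 2) ^+ 2 +
      (f p + g p) ^+ 4); last by ring.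
    by apply: addr_ge0; [rewrite mulr_ge0 ?sqr_ge0|rewrite exprn_even_ge0].
rewrite (ge0_integralZl mu measurableT (emeasurable_funD (m4 _ mf) (m4 _ mg))
  (fun p _ => adde_ge0 (a40 f p) (a40 g p)) e80).
rewrite (ge0_integralD mu measurableT (fun p _ => a40 f p) (m4 _ mf)
  (fun p _ => a40 g p) (m4 _ mg)).
apply: le_trans (lee_wpmul2l e80 (leeD ft gt')) _.
by rewrite -EFinD -EFinM lee_fin le_eqVlt; apply/orP; left; apply/eqP; ring.
Qed.

End integral_inequalities.

(** * Sequences of integrable functions *)

Section ae_limits.
Context d (T : measurableType d) (R : realType) (mu : {measure set T -> \bar R}).
Local Open Scope ereal_scope.

(** The sum of the |h k| has a finite integral, hence is finite almost
    everywhere, and absolutely convergent series converge. *)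
Lemma ae_summable (h : nat -> T -> R) :
  (forall k, measurable_fun setT (h k)) ->
  (forall k, \int[mu]_x `|h k x|%:E <= (1 / (2 ^ k.+1)%:R)%:E) ->
  {ae mu, forall x, cvgn (series (fun k => h k x))}.
Proof.
move=> mh hle.
have mh' k : measurable_fun setT (fun x => `|h k x|%:E).
  by apply/measurable_EFinP; exact: measurableT_comp.
have h0 k x : 0 <= `|h k x|%:E by rewrite lee_fin.
pose S x := \sum_(0 <= k <oo) `|h k x|%:E.
have mS : measurable_fun setT S by apply: ge0_emeasurable_sum.
have S0 x : 0 <= S x by apply: nneseries_ge0.
have iS : mu.-integrable setT S.
  apply/integrableP; split=> //.
  under eq_integral do rewrite gee0_abs//.
  rewrite integral_nneseries//.
  apply: le_lt_trans (le_trans (lee_nneseries _ _) (epsilon_trick0 xpredT ler01)) _ => //.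
    by move=> k _ _; apply: integral_ge0.
  by rewrite ltry.
have := integrable_ae measurableT iS; apply: filterS => x /(_ Logic.I) Sx.
apply: normed_cvg; apply: nnseries_is_cvg; first by move=> k /=.
by move: Sx; rewrite ge0_fin_numE.
Qed.

Lemma ae_cvg0 (h : nat -> T -> R) :
  (forall k, measurable_fun setT (h k)) ->
  (forall k, \int[mu]_x `|h k x|%:E <= (1 / (2 ^ k.+1)%:R)%:E) ->
  {ae mu, forall x, h k x @[k --> \oo] --> (0%R : R)}.
Proof.
move=> mh hle; have := ae_summable mh hle.
by apply: filterS => x; exact: cvg_series_cvg_0.
Qed.

Lemma ae_cvg_L1 (f : nat -> T -> R) (u : T -> R) :
  (forall k, measurable_fun setT (f k)) -> measurable_fun setT u ->
  (forall k, \int[mu]_x `|u x - f k x|%:E <= (1 / (2 ^ k.+1)%:R)%:E) ->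
  {ae mu, forall x, f k x @[k --> \oo] --> u x}.
Proof.
move=> mf mu' fu.
have mh k : measurable_fun setT (fun x => u x - f k x)%R by exact: measurable_funB.
apply: filterS (ae_cvg0 mh fu) => x hx.
rewrite -[u x]subr0 (_ : (fun k => f k x) = (fun k => u x - (u x - f k x))%R).
  by apply: cvgB hx; exact: cvg_cst.
by apply/funext => k; rewrite subKr.
Qed.

(** The increments are summable almost everywhere.  The limit is taken to be
    the upper limit, which is measurable on the whole space, including the
    null set where the sequence diverges. *)
Lemma ae_cvg_rapid_cauchy (f : nat -> T -> R) :
  (forall k, measurable_fun setT (f k)) ->
  (forall k, \int[mu]_x `|f k.+1 x - f k x|%:E <= (1 / (2 ^ k.+1)%:R)%:E) ->
  exists2 l : T -> R, measurable_fun setT l &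
    {ae mu, forall x, f k x @[k --> \oo] --> l x}.
Proof.
move=> mf fle.
exists (fun x => fine (limn_esup (fun k => (f k x)%:E))).
  apply: measurableT_comp => //; apply: measurable_fun_limn_esup => k.
  exact/measurable_EFinP.
have mh k : measurable_fun setT (fun x => f k.+1 x - f k x)%R.
  exact: measurable_funB.
have := ae_summable mh fle; apply: filterS => x /cvg_ex[s sx].
have fx : f k x @[k --> \oo] --> (f 0%N x + s)%R.
  rewrite (_ : (fun k => f k x) =
    (fun k => f 0%N x + series (telescope (f ^~ x)) k)%R).
    by apply: cvgD => //; exact: cvg_cst.
  by apply/funext => k; exact: eq_sum_telescope.
have fxE : (f k x)%:E @[k --> \oo] --> (f 0%N x + s)%:E.
  by apply: cvg_EFin; [exact: nearW|exact: fx].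
by rewrite (cvg_limn_einf_sup fxE).2.
Qed.

Lemma limn_einf_le (u : (\bar R)^nat) (C : \bar R) :
  (\forall k \near \oo, u k <= C) -> limn_einf u <= C.
Proof.
move=> [N _ uC]; rewrite limn_einf_lim; apply: lime_le.
  by apply: ereal_nondecreasing_is_cvgn; exact: nondecreasing_einfs.
apply: nearW => n; apply: (@le_trans _ _ (u (maxn n N))).
  by apply: ereal_inf_lbound; exists (maxn n N) => //=; exact: leq_maxl.
by apply: uC; exact: leq_maxr.
Qed.

Lemma measurable_fun_limn_einf (f : nat -> T -> \bar R) :
  (forall k, measurable_fun setT (f k)) ->
  measurable_fun setT (fun x => limn_einf (f ^~ x)).
Proof.
move=> mf; rewrite (_ : (fun x => _) =
  (fun x => - limn_esup (fun k => - f k x))); last first.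
  apply/funext => x; rewrite -limn_einfN; congr limn_einf.
  by apply/funext => k /=; rewrite oppeK.
apply: measurableT_comp => //; apply: measurable_fun_limn_esup => k.
exact: measurableT_comp.
Qed.

Lemma limn_einf_ge0 (u : (\bar R)^nat) : (forall k, 0 <= u k) -> 0 <= limn_einf u.
Proof.
move=> u0; rewrite limn_einf_lim; apply: lime_ge.
  by apply: ereal_nondecreasing_is_cvgn; exact: nondecreasing_einfs.
by apply: nearW => n; apply/ereal_infP => _ [k _ <-].
Qed.

(** Fatou's lemma in the form used to carry bounds to almost everywhere
    limits: h is a 4-th power or an absolute value. *)
Lemma integral_comp_le_ae_limit (h : R -> R) (g : nat -> T -> R) (l : T -> R) (C : \bar R) :
  continuous h -> (forall r, 0 <= h r)%R ->
  (forall k, measurable_fun setT (g k)) -> measurable_fun setT l ->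
  {ae mu, forall x, g k x @[k --> \oo] --> l x} ->
  (\forall k \near \oo, \int[mu]_x (h (g k x))%:E <= C) ->
  \int[mu]_x (h (l x))%:E <= C.
Proof.
move=> ch h0 mg ml gl gC.
have mh : measurable_fun setT h by exact: continuous_measurable_fun.
have mg' k : measurable_fun setT (fun x => (h (g k x))%:E).
  by apply/measurable_EFinP; exact: measurableT_comp.
have g0' k x : 0 <= (h (g k x))%:E by rewrite lee_fin.
have -> : \int[mu]_x (h (l x))%:E = \int[mu]_x limn_einf (fun k => (h (g k x))%:E).
  apply: ge0_ae_eq_integral => //.
  - by apply/measurable_EFinP; exact: measurableT_comp.
  - exact: measurable_fun_limn_einf.
  - by move=> x _; rewrite lee_fin.
  - by move=> x _; exact: limn_einf_ge0.
  - apply: filterS gl => x gx _.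
    have hgx : h (g k x) @[k --> \oo] --> h (l x).
      exact: (cvg_comp _ _ gx (ch (l x))).
    have gxE : (h (g k x))%:E @[k --> \oo] --> (h (l x))%:E.
      by apply: cvg_EFin; [exact: nearW|exact: hgx].
    by rewrite (cvg_limn_einf_sup gxE).1.
apply: le_trans (fatou _ _ _ _) _ => //.
exact: limn_einf_le.
Qed.

Local Close Scope ereal_scope.

Lemma le_rapid_cauchy_dist (f : nat -> T -> R) :
  (forall k, measurable_fun setT (f k)) ->
  (forall k, \int[mu]_p `|f k.+1 p - f k p|%:E <= (1 / (2 ^ k.+1)%:R)%:E)%E ->
  forall k j, (\int[mu]_p `|f (k + j)%N p - f k p|%:E <=
    (1 / (2 ^ k)%:R - 1 / (2 ^ (k + j))%:R)%:E)%E.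
Proof.
move=> mf fle k; elim=> [|j IH].
  rewrite addn0 subrr (eq_integral (cst 0%E)) ?integral0// => p _.
  by rewrite subrr normr0.
have mB i i' : measurable_fun setT (fun p => `|f i p - f i' p|%:E).
  apply/measurable_EFinP; apply: measurableT_comp => //.
  exact: measurable_funB.
have B0 i i' p : (0 <= `|f i p - f i' p|%:E)%E by rewrite lee_fin.
rewrite addnS; apply: (@le_trans _ _ (\int[mu]_p
    (`|f (k + j).+1 p - f (k + j)%N p|%:E + `|f (k + j)%N p - f k p|%:E))%E).
  apply: ge0_le_integral => //.
  - by apply: emeasurable_funD; [exact: (mB (k + j).+1 (k + j)%N)|exact: (mB (k + j)%N k)].
  - move=> p _; rewrite -EFinD lee_fin.
    by rewrite -[X in `|X| <= _](subrKA (f (k + j)%N p)); exact: ler_normD.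
rewrite (ge0_integralD mu measurableT (fun p _ => B0 _ _ p) (mB _ _)
  (fun p _ => B0 _ _ p) (mB _ _)).
apply: le_trans (leeD (fle _) IH) _.
rewrite -EFinD lee_fin expnS natrM.
have : 1 / (2 ^ (k + j))%:R = 2 * (1 / (2 * (2 ^ (k + j))%:R)) :> R.
  by field; rewrite pnatr_eq0 expn_eq0.
by move=> ->; lra.
Qed.

Lemma le_rapid_limit_dist (f : nat -> T -> R) (l : T -> R) :
  (forall k, measurable_fun setT (f k)) -> measurable_fun setT l ->
  {ae mu, forall p, f k p @[k --> \oo] --> l p} ->
  (forall k, \int[mu]_p `|f k.+1 p - f k p|%:E <= (1 / (2 ^ k.+1)%:R)%:E)%E ->
  forall k, (\int[mu]_p `|f k p - l p|%:E <= (1 / (2 ^ k)%:R)%:E)%E.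
Proof.
move=> mf ml fl fle k.
have H : (\int[mu]_p `|l p - f k p|%:E <= (1 / (2 ^ k)%:R)%:E)%E.
  apply: (@integral_comp_le_ae_limit (fun r => `|r|) (fun j p => f (k + j)%N p - f k p)
      (fun p => l p - f k p)) => //.
  - exact: norm_continuous.
  - by move=> j; exact: measurable_funB.
  - exact: measurable_funB.
  - apply: filterS fl => p fp.
    apply: cvgB; last exact: cvg_cst.
    rewrite (_ : (fun j => f (k + j)%N p) = [sequence f (j + k)%N p]_j).
      by rewrite (cvg_shiftn k (fun j => f j p)).
    by apply/funext => j /=; rewrite addnC.
  - apply: nearW => j; apply: le_trans (le_rapid_cauchy_dist mf fle k j) _.
    by rewrite lee_fin gerBl divr_ge0.
by under eq_integral do rewrite distrC.
Qed.
End ae_limits.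

(** * Extraction of rapidly Cauchy subsequences *)

Section ultra.
Context {R : realType}.

(** By compactness the image of U has a cluster point c in [-B, B].  Either
    the set where g is within e of c or its complement belongs to U; the
    complement would contradict clustering. *)
Lemma ultra_bounded_cvg (U : set_system nat) (g : nat -> R) (B : R) :
  UltraFilter U -> (forall n, `|g n| <= B) ->
  exists c, forall e, 0 < e -> \forall n \near U, `|g n - c| < e.
Proof.
move=> UU gB.
have UF : ProperFilter U by exact: ultra_proper.
have cB : compact (`[- B, B] : set R) by exact: segment_compact.
have gU : U (g @^-1` `[- B, B]%classic).
  by apply: filterE => n /=; rewrite in_itv/= -ler_norml.
have [c [_ clc]] := cB _ (fmap_proper_filter g UF) gU.
exists c => e e0.
have [//|Uc] := in_ultra_setVsetC [set n | `|g n - c| < e] UU.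
have Uc' : U (g @^-1` (~` ball c e)).
  by apply: filterS Uc => n /=; rewrite /ball/= distrC.
have [z [nbz bz]] := clc _ _ Uc' (nbhsx_ballx c e e0).
by [].
Qed.

(** The role of the diagonal argument is played by one ultrafilter U finer than
    eventuality.  Pick S k in U on which D is at most 2^-(k+1).  The finite
    intersections W k of the S k are in U, hence contain arbitrarily large
    integers; choosing s k in W k makes both s k and s (k+1) members of S k. *)
Lemma rapid_cauchy_subseq (D : nat -> nat -> \bar R) :
  (forall U : set_system nat, UltraFilter U -> \oo `<=` U ->
    forall e : R, 0 < e ->
    exists2 S, U S & forall n k, S n -> S k -> (D n k <= e%:E)%E) ->
  exists2 s : nat -> nat, {homo s : i j / (i < j)%N} &
    forall k, (D (s k.+1) (s k) <= (1 / (2 ^ k.+1)%:R)%:E)%E.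
Proof.
move=> DU.
have [U [UU subU]] := @ultraFilterLemma _ \oo _.
have UF : ProperFilter U by exact: ultra_proper.
have e0 k : 0 < (1 / (2 ^ k.+1)%:R : R) by rewrite divr_gt0// ltr0n expn_gt0.
have /choice[S SP] : forall k, exists S, U S /\ forall n p, S n -> S p ->
    (D n p <= (1 / (2 ^ k.+1)%:R)%:E)%E.
  by move=> k; have [S US SD] := DU U UU subU _ (e0 k); exists S.
pose W k := \bigcap_(j in [set j | (j <= k)%N]) S j.
have UW k : U (W k).
  elim: k => [|k IH].
    apply: filterS (SP 0%N).1 => n Sn j /=; rewrite leqn0 => /eqP ->; exact: Sn.
  apply: filterS (filterI IH (SP k.+1).1) => n [Wn Sn] j /=.
  by rewrite leq_eqVlt ltnS => /predU1P[->//|jk]; exact: Wn.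
have pick (km : nat * nat) : exists n, W km.1 n /\ (km.2 < n)%N.
  have Um : U [set n | (km.2 < n)%N] by apply: subU; exists km.2.+1.
  have [n [Wn mn]] := filter_ex (filterI (UW km.1) Um).
  by exists n.
have /choice[p pP] := pick.
pose fix s k := if k is k'.+1 then p (k'.+1, s k') else p (0%N, 0%N).
have sW k : W k (s k).
  by case: k => [|k]; [exact: (pP (0%N, 0%N)).1|exact: (pP (k.+1, s k)).1].
have sS k : (s k < s k.+1)%N by exact: (pP (k.+1, s k)).2.
exists s.
  by apply: homo_ltn => // ? ? ?; exact: ltn_trans.
move=> k; apply: (SP k).2.
  by apply: (sW k.+1) => /=.
by apply: (sW k) => /=.
Qed.
End ultra.

(** * Measurability and iterated integrals on the unit square *)

Section measurability.
Context {R : realType}.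
Local Notation mR := (measurableTypeR R).

(** The plane carries the product of the Borel sigma-algebras, so its open sets
    must be written as countable unions of rectangles: squares with rational
    centre and rational half-width. *)
Lemma open_measurable_prod (U : set (R * R)) :
  open U -> measurable (U : set (mR * mR)).
Proof.
move=> oU.
pose B (t : rat * rat * rat) : set (R * R) :=
  ball (ratr t.1.1 : R) (ratr t.2) `*` ball (ratr t.1.2 : R) (ratr t.2).
have -> : U = \bigcup_(t in [set t | B t `<=` U]) B t.
  apply/seteqP; split=> [[x y] Uxy|p [t tU /tU//]].
  have /nbhs_ballP[e /= e0 eU] : nbhs (x, y) U by exact: open_nbhs_nbhs.
  have /rat_in_itvoo[s] : 0 < e / 2 by rewrite divr_gt0.
  rewrite in_itv/= => /andP[s0 se].
  have hx (z : R) : exists q : rat, ball z (ratr s) (ratr q : R).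
    have /rat_in_itvoo[q] : z < z + ratr s by rewrite ltrDl.
    rewrite in_itv/= => /andP[q1 q2]; exists q.
    rewrite /ball/= distrC ltr_norml; apply/andP; split; lra.
  have [q qx] := hx x; have [r ry] := hx y.
  exists (q, r, s) => /=; last first.
    by split; exact: ball_sym.
  move=> [a b]/= [aq br]; apply: eU; split => /=.
    apply: (@le_ball R R x (ratr s + ratr s) e); first lra.
    exact: ball_triangle qx aq.
  apply: (@le_ball R R y (ratr s + ratr s) e); first lra.
  exact: ball_triangle ry br.
rewrite bigcup_mkcond; apply: countable_bigcupT_measurable => // t.
case: ifPn => _ //; apply: measurableX; rewrite ball_itv; exact: measurable_itv.
Qed.

Lemma continuous_measurable_prod (f : R * R -> R) :
  continuous f -> measurable_fun [set: mR * mR] f.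
Proof.
move=> /continuousP cf; apply: (measurability _ (RGenOpens.measurableE R)).
move=> _ [_ [a [b ->] <-]]; rewrite setTI; apply: open_measurable_prod.
exact/cf/interval_open.
Qed.

End measurability.

Lemma measurable_funTS_restrict d d' (T : measurableType d)
    (U : measurableType d') (D : set T) (f : T -> U) :
  measurable D -> measurable_fun setT f -> measurable_fun setT (f \_ D).
Proof.
by move=> mD mf; apply: (measurable_restrictT f mD).1; exact: measurable_funTS.
Qed.

Section tonelli.
Context {R : realType}.
Local Notation mR := (measurableTypeR R).
Local Notation lambda := (@lebesgue_measure R).
Local Notation I := (`]0%R, 1%R[%classic : set R).
Local Open Scope ereal_scope.

Lemma measurable_partial_integral (F : mR * mR -> \bar R) (D : set mR) :
  measurable D -> measurable_fun [set: mR * mR] F -> (forall p, 0 <= F p) ->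
  measurable_fun [set: mR] (fun y => \int[lambda]_(x in D) F (x, y)) /\
  measurable_fun [set: mR] (fun x => \int[lambda]_(y in D) F (x, y)).
Proof.
move=> mD mF F0; split.
- have -> : (fun y => \int[lambda]_(x in D) F (x, y)) =
      fubini_G lambda ((F \_ (D `*` setT)) : mR * mR -> \bar R).
    apply/funext => y; rewrite /fubini_G [LHS]integral_mkcond.
    by apply: eq_integral => x _; rewrite !patchE in_setX/= in_setT andbT.
  apply: measurable_fun_fubini_tonelli_G.
    by apply: measurable_funTS_restrict => //; exact: measurableX.
  by move=> p; rewrite patchE; case: ifP.
- have -> : (fun x => \int[lambda]_(y in D) F (x, y)) =
      fubini_F lambda ((F \_ (setT `*` D)) : mR * mR -> \bar R).
    apply/funext => y; rewrite /fubini_F [LHS]integral_mkcond.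
    by apply: eq_integral => x _; rewrite !patchE in_setX/= in_setT.
  apply: measurable_fun_fubini_tonelli_F.
    by apply: measurable_funTS_restrict => //; exact: measurableX.
  by move=> p; rewrite patchE; case: ifP.
Qed.

(** The restricted measure gives mass 0 to the complement of the square and
    agrees with the product measure inside. *)
Lemma integral_muOE (F : mR * mR -> \bar R) :
  measurable_fun [set: mR * mR] F -> (forall p, 0 <= F p) ->
  \int[muO R]_p F p = \int[lambda \x lambda]_p ((F \_ (@Omega R)) : mR * mR -> \bar R) p.
Proof.
move=> mF F0; have mO : measurable (@Omega R : set (mR * mR)) := @measurable_Omega R.
rewrite -integral_mkcond -[in LHS](setUv (@Omega R)) ge0_integral_setU//=; first last.
- exact/disj_setPCl.
- exact: measurable_funTS.
- exact: measurableC.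
have mOC : measurable (~` @Omega R : set (mR * mR)) by exact: measurableC.
have muOC : muO R (~` @Omega R) = 0.
  by rewrite /muO/= /mrestr setICl measure0.
have -> : \int[muO R]_(p in ~` @Omega R) F p = 0.
  apply: (null_set_integral mOC _ muOC).
  exact: measurable_funTS.
rewrite adde0; apply: eq_measure_integral => A mA AO.
by rewrite /muO /= /mrestr setIidl.
Qed.

Lemma integral_muO_xy (F : mR * mR -> \bar R) :
  measurable_fun [set: mR * mR] F -> (forall p, 0 <= F p) ->
  \int[muO R]_p F p = \int[lambda]_(x in I) \int[lambda]_(y in I) F (x, y).
Proof.
move=> mF F0; have mO : measurable (@Omega R : set (mR * mR)) := @measurable_Omega R.
rewrite integral_muOE// fubini_tonelli1; last 2 first.
- exact: measurable_funTS_restrict.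
- by move=> p; rewrite patchE; case: ifP.
rewrite [RHS]integral_mkcond; apply: eq_integral => x _.
rewrite /fubini_F [RHS]patchE; case: ifPn => xI.
  rewrite [RHS]integral_mkcond; apply: eq_integral => y _.
  by rewrite !patchE /Omega in_setX/= xI.
by apply: integral0_eq => y _; rewrite patchE /Omega in_setX/= (negbTE xI).
Qed.

Lemma tonelli_swap (F : mR * mR -> \bar R) (D E : set mR) :
  measurable D -> measurable E ->
  measurable_fun [set: mR * mR] F -> (forall p, 0 <= F p) ->
  \int[lambda]_(x in D) \int[lambda]_(y in E) F (x, y) =
  \int[lambda]_(y in E) \int[lambda]_(x in D) F (x, y).
Proof.
move=> mD mE mF F0.
pose G : mR * mR -> \bar R := F \_ (D `*` E).
have mG : measurable_fun [set: mR * mR] G.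
  by apply: measurable_funTS_restrict => //; exact: measurableX.
have G0 p : 0 <= G p by rewrite /G patchE; case: ifP.
rewrite [LHS]integral_mkcond [RHS]integral_mkcond.
transitivity (\int[lambda]_x \int[lambda]_y G (x, y)).
  apply: eq_integral => x _; rewrite patchE; case: ifPn => xD.
    rewrite integral_mkcond; apply: eq_integral => y _.
    by rewrite /G !patchE in_setX/= xD.
  by rewrite integral0_eq// => y _; rewrite /G patchE in_setX/= (negbTE xD).
rewrite (fubini_tonelli G mG G0).
apply: eq_integral => y _; rewrite patchE; case: ifPn => yE.
  rewrite [RHS]integral_mkcond; apply: eq_integral => x _.
  by rewrite /G !patchE in_setX/= yE andbT.
by rewrite /fubini_G integral0_eq// => x _; rewrite /G patchE in_setX/= (negbTE yE) andbF.
Qed.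

Lemma integral_muO_yx (F : mR * mR -> \bar R) :
  measurable_fun [set: mR * mR] F -> (forall p, 0 <= F p) ->
  \int[muO R]_p F p = \int[lambda]_(y in I) \int[lambda]_(x in I) F (x, y).
Proof.
by move=> mF F0; apply: etrans (integral_muO_xy mF F0) _; exact: tonelli_swap.
Qed.

Lemma muO_setT : muO R setT = 1.
Proof.
have I1 : lambda I = 1.
  by rewrite lebesgue_measure_itv/= lte_fin ltr01 -EFinB subr0.
rewrite /muO /= /mrestr setTI.
transitivity (lambda I * lambda I); last by rewrite I1 mule1.
exact: product_measure1E.
Qed.

End tonelli.

(** * A Poincare inequality on a grid *)

Section grid.
Context {R : realType}.
Local Notation mR := (measurableTypeR R).
Local Notation lambda := (@lebesgue_measure R).
Definition cell (N i : nat) : set R := `[i%:R / N%:R, i.+1%:R / N%:R[%classic.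

Local Open Scope ereal_scope.

(** If f keeps a constant sign on J, the integral of |f| is |integral of f|.
    Otherwise f takes values of both signs, and |f| <= D everywhere on J. *)
Lemma osc_integral d (T : measurableType d) (mu : {measure set T -> \bar R})
    (J : set T) (f : T -> R) (D : \bar R) :
  measurable J -> mu.-integrable J (EFin \o f) -> 0 <= D ->
  (forall x x', J x -> J x' -> `|f x - f x'|%:E <= D) ->
  \int[mu]_(x in J) `|f x|%:E <= D * mu J + `|\int[mu]_(x in J) (f x)%:E|.
Proof.
move=> mJ intf D0 osc.
have DmuJ : 0 <= D * mu J by rewrite mule_ge0.
have mf : measurable_fun J f by apply/measurable_EFinP; case/integrableP: intf.
have [fge0|] := pselect (forall x, J x -> (0 <= f x)%R).
  under eq_integral => x /set_mem/fge0 fx do rewrite ger0_norm//.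
  by rewrite -[leLHS]add0e leeD// lee_abs.
move=> /existsNP[a /not_implyP[Ja /negP]]; rewrite -ltNge => fa.
have [fle0|] := pselect (forall x, J x -> (f x <= 0)%R).
  have -> : \int[mu]_(x in J) `|f x|%:E = - \int[mu]_(x in J) (f x)%:E.
    rewrite -integralN; last exact: integrable_add_def intf.
    by apply: eq_integral => x /set_mem/fle0 fx; rewrite ler0_norm.
  by rewrite -[leLHS]add0e leeD// -abseN lee_abs.
move=> /existsNP[b /not_implyP[Jb /negP]]; rewrite -ltNge => fb.
suff : \int[mu]_(x in J) `|f x|%:E <= D * mu J.
  by move=> /le_trans; apply; rewrite leeDl.
rewrite -integral_cst//; apply: ge0_le_integral => //.
- apply/measurable_EFinP; exact: measurableT_comp.
- move=> x Jx; have [fx|fx] := ger0P (f x).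
    apply: le_trans (osc _ _ Jx Ja); rewrite lee_fin.
    by rewrite [leRHS]ger0_norm; lra.
  apply: le_trans (osc _ _ Jb Jx); rewrite lee_fin.
  by rewrite [leRHS]ger0_norm; lra.
Qed.

Lemma cell_measurable N i : measurable (cell N i : set mR).
Proof. exact: measurable_itv. Qed.

Lemma cell_lebesgue (N i : nat) : (0 < N)%N -> lambda (cell N i) = (N%:R^-1)%:E.
Proof.
move=> N0; rewrite /cell lebesgue_measure_itv/= lte_fin.
rewrite ltr_pM2r ?invr_gt0 ?ltr0n// ltr_nat ltnSn.
by rewrite -EFinB -mulrBl -natrB// subSnn mul1r.
Qed.

Lemma integral_cells (N : nat) (F : mR -> \bar R) : (0 < N)%N ->
  measurable_fun setT F -> (forall x, 0 <= F x) ->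
  \int[lambda]_(x in `[0%R, 1%R[%classic) F x =
  \sum_(i < N) \int[lambda]_(x in cell N i) F x.
Proof.
move=> N0 mF F0.
suff H n : \int[lambda]_(x in `[0%R, (n%:R / N%:R)%R[%classic) F x =
    \sum_(i < n) \int[lambda]_(x in cell N i) F x.
  by rewrite -H divff// pnatr_eq0 -lt0n.
elim: n => [|n IH]; first by rewrite mul0r set_itvco0 integral_set0 big_ord0.
have mC := cell_measurable N n.
rewrite big_ord_recr/= -IH -ge0_integral_setU//=; last 2 first.
- exact: measurable_funTS.
- apply/disj_setPS => x []/=; rewrite /cell/= !in_itv/= => /andP[_ xn] /andP[nx _].
  by move: (lt_le_trans xn nx); rewrite ltxx.
congr (integral _ _ _); rewrite /cell; apply/seteqP; split => x /=; rewrite !in_itv/=.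
  move=> /andP[x0 xn]; have [h|h] := ltP x (n%:R / N%:R)%R.
    by left; rewrite x0.
  by right; apply/andP; split.
have hN : (0 < (N%:R : R)^-1)%R by rewrite invr_gt0 ltr0n.
move=> [/andP[x0 xn]|/andP[nx xn]]; rewrite ?x0/=.
  by rewrite (lt_le_trans xn)// ler_pM2r// ler_nat.
by rewrite xn andbT (le_trans _ nx)// mulr_ge0// ltW.
Qed.

(** The function G plays the part of |f'|: only the bound that it gives for the
    oscillation of f on a cell matters, so that f may be an integral depending
    on a parameter, with no differentiation under the integral sign. *)
Lemma poincare_cells (N : nat) (f : mR -> R) (G : mR -> \bar R) : (0 < N)%N ->
  measurable_fun setT f -> measurable_fun setT G -> (forall x, 0 <= G x) ->
  (forall i, lambda.-integrable (cell N i) (EFin \o f)) ->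
  (forall i x x', cell N i x -> cell N i x' ->
    `|f x - f x'|%:E <= \int[lambda]_(t in cell N i) G t) ->
  \int[lambda]_(x in `[0%R, 1%R[%classic) `|f x|%:E <=
  (N%:R^-1)%:E * \int[lambda]_(x in `[0%R, 1%R[%classic) G x +
  \sum_(i < N) `|\int[lambda]_(x in cell N i) (f x)%:E|.
Proof.
move=> N0 mf mG G0 intf osc.
rewrite (integral_cells N0)//; last by apply/measurable_EFinP/measurableT_comp.
rewrite (integral_cells N0)// ge0_sume_distrr; last first.
  by move=> i _; apply: integral_ge0.
rewrite -big_split/=; apply: lee_sum => i _.
rewrite -(cell_lebesgue i N0) muleC.
apply: (osc_integral _ (intf i) _ (osc i)) => //.
  exact: cell_measurable.
by apply: integral_ge0.
Qed.
End grid.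

Section grid2.
Context {R : realType}.
Local Notation mR := (measurableTypeR R).
Local Notation lambda := (@lebesgue_measure R).

Lemma bounded_integrable d (T : measurableType d)
    (mu : {measure set T -> \bar R}) (J : set T) (f : T -> R) (B : R) :
  measurable J -> (mu J < +oo)%E -> measurable_fun setT f ->
  (forall x, `|f x| <= B) -> mu.-integrable J (EFin \o f).
Proof.
move=> mJ Jfin mf fB; apply: measurable_bounded_integrable => //.
  exact: measurable_funTS.
exists B; split; first exact: num_real.
by move=> M /ltW BM x _; apply: le_trans BM; exact: fB.
Qed.

Lemma le_Rintegral_bound d (T : measurableType d)
    (mu : {measure set T -> \bar R}) (J : set T) (f : T -> R) (B : R) :
  measurable J -> (mu J < +oo)%E -> measurable_fun setT f ->
  (forall x, `|f x| <= B) ->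
  `|\int[mu]_(x in J) f x| <= B * fine (mu J).
Proof.
move=> mJ Jfin mf fB.
have intf := bounded_integrable mJ Jfin mf fB.
apply: le_trans (le_normr_Rintegral mJ intf) _.
rewrite -Rintegral_cst//; apply: le_Rintegral => //.
  apply: (bounded_integrable (B := B)) => //; first exact: measurableT_comp.
  by move=> x; rewrite normr_id.
by apply: (bounded_integrable (B := `|B|)).
Qed.

Lemma cell_lty (N i : nat) : (0 < N)%N -> (lambda (@cell R N i) < +oo)%E.
Proof. by move=> N0; rewrite cell_lebesgue// ltry. Qed.

Definition grid_integral (N i j : nat) (w : mR * mR -> R) : R :=
  \int[lambda]_(y in @cell R N j) \int[lambda]_(x in @cell R N i) w (x, y).

Section strip.
Variables (w : mR * mR -> R) (B : R).
Hypotheses (mw : measurable_fun [set: mR * mR] w) (wB : forall p, `|w p| <= B).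

Lemma integrable_section (N i : nat) (y : mR) : (0 < N)%N ->
  lambda.-integrable (@cell R N i) (EFin \o (fun x => w (x, y))).
Proof.
move=> N0; apply: (bounded_integrable (B := B)) => //.
- exact: cell_measurable.
- exact: cell_lty.
- exact: measurableT_comp mw (measurable_pair2 _).
Qed.

Lemma measurable_strip_integral (N i : nat) : (0 < N)%N ->
  measurable_fun [set: mR] (fun y => \int[lambda]_(x in @cell R N i) w (x, y)).
Proof.
move=> N0.
have mC := @cell_measurable R N i; have lC := cell_lty i N0.
rewrite (_ : (fun y => _) = (fun y =>
  fine (\int[lambda]_(x in @cell R N i) (w (x, y) + B)%:E)%E
    - B * fine (lambda (@cell R N i)))).
  (* Adding B makes the integrand nonnegative, so that Tonelli applies. *)
  apply: measurable_funB => //; apply: measurableT_comp => //.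
  have mwB : measurable_fun [set: mR * mR] (fun p => (w p + B)%:E).
    by apply/measurable_EFinP; exact: measurable_funD.
  apply: (measurable_partial_integral mC mwB _).1 => p.
  by rewrite lee_fin; have := wB p; rewrite ler_norml => /andP[+ _]; lra.
apply/funext => y; rewrite -[fine _]/(\int[lambda]_(x in _) _) RintegralD//.
- by rewrite Rintegral_cst// addrK.
- exact: integrable_section.
- by apply: (bounded_integrable (B := `|B|)).
Qed.

Lemma le_strip_integral (N i : nat) y : (0 < N)%N ->
  `|\int[lambda]_(x in @cell R N i) w (x, y)| <= B * fine (lambda (@cell R N i)).
Proof.
move=> N0; apply: le_Rintegral_bound => //.
- exact: cell_measurable.
- exact: cell_lty.
- exact: measurableT_comp mw (measurable_pair2 _).
Qed.

Lemma integrable_strip_integral (N i j : nat) : (0 < N)%N ->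
  lambda.-integrable (@cell R N j)
    (EFin \o (fun y => \int[lambda]_(x in @cell R N i) w (x, y))).
Proof.
move=> N0; apply: bounded_integrable => //; last by move=> y; exact: le_strip_integral.
- exact: cell_measurable.
- exact: cell_lty.
- exact: measurable_strip_integral.
Qed.

End strip.

Lemma grid_integralB (N i j : nat) (w v : mR * mR -> R) (B B' : R) : (0 < N)%N ->
  measurable_fun [set: mR * mR] w -> (forall p, `|w p| <= B) ->
  measurable_fun [set: mR * mR] v -> (forall p, `|v p| <= B') ->
  grid_integral N i j (fun p => w p - v p) =
  grid_integral N i j w - grid_integral N i j v.
Proof.
move=> N0 mw wB mv vB; rewrite /grid_integral -RintegralB; last 3 first.
- exact: cell_measurable.
- exact: integrable_strip_integral mw wB _ _ _ N0.
- exact: integrable_strip_integral mv vB _ _ _ N0.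
apply: eq_Rintegral => y _; rewrite RintegralB//.
- exact: cell_measurable.
- exact: integrable_section mw wB _ _ _ N0.
- exact: integrable_section mv vB _ _ _ N0.
Qed.

Local Open Scope ereal_scope.

Local Notation J := (`[0%R, 1%R[%classic : set R).

(** The one-dimensional inequality is used twice: in x for each fixed y, then in
    y for the functions g i obtained by integrating w over the i-th column of
    cells; by Tonelli, G2 integrated over that column bounds their
    oscillation. *)
Lemma poincare_grid (N : nat) (w : mR * mR -> R) (B : R)
    (G1 G2 : mR * mR -> \bar R) : (0 < N)%N ->
  measurable_fun [set: mR * mR] w -> (forall p, (`|w p| <= B)%R) ->
  measurable_fun [set: mR * mR] G1 -> (forall p, 0 <= G1 p) ->
  measurable_fun [set: mR * mR] G2 -> (forall p, 0 <= G2 p) ->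
  (forall y i x x', @cell R N i x -> @cell R N i x' ->
    `|w (x, y) - w (x', y)|%:E <= \int[lambda]_(t in @cell R N i) G1 (t, y)) ->
  (forall x j y y', @cell R N j y -> @cell R N j y' ->
    `|w (x, y) - w (x, y')|%:E <= \int[lambda]_(t in @cell R N j) G2 (x, t)) ->
  \int[lambda]_(y in J) \int[lambda]_(x in J) `|w (x, y)|%:E <=
  (N%:R^-1)%:E * (\int[lambda]_(y in J) \int[lambda]_(x in J) G1 (x, y) +
    \int[lambda]_(y in J) \int[lambda]_(x in J) G2 (x, y)) +
  \sum_(i < N) \sum_(j < N) `|grid_integral N i j w|%:E.
Proof.
move=> N0 mw wB mG1 G10 mG2 G20 osc1 osc2.
have mJ : measurable (J : set mR) by exact: measurable_itv.
pose g i y := (\int[lambda]_(x in @cell R N i) w (x, y))%R.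
have mg i := measurable_strip_integral mw wB i N0.
have gE i y : \int[lambda]_(x in @cell R N i) (w (x, y))%:E = (g i y)%:E.
  by rewrite fineK//; apply: integrable_fin_num; [exact: cell_measurable|exact: integrable_section].
have mwE : measurable_fun [set: mR * mR] (fun p => `|w p|%:E).
  by apply/measurable_EFinP; exact: measurableT_comp.
have [mIG1 _] := measurable_partial_integral mJ mG1 G10.
have sec1 y : \int[lambda]_(x in J) `|w (x, y)|%:E <=
    (N%:R^-1)%:E * \int[lambda]_(x in J) G1 (x, y) + \sum_(i < N) `|g i y|%:E.
  have := @poincare_cells R N (fun x => w (x, y)) (fun x => G1 (x, y)) N0
    (measurableT_comp mw (measurable_pair2 _)) (measurableT_comp mG1 (measurable_pair2 _))
    (fun x => G10 _) (fun i => integrable_section mw wB i y N0) (osc1 y).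
  by under eq_bigr do rewrite gE.
have sec2 (i : 'I_N) : \int[lambda]_(y in J) `|g i y|%:E <=
    (N%:R^-1)%:E * \int[lambda]_(y in J) \int[lambda]_(x in @cell R N i) G2 (x, y) +
    \sum_(j < N) `|grid_integral N i j w|%:E.
  have mC := @cell_measurable R N i.
  have mIG2 := (measurable_partial_integral mC mG2 G20).1.
  have := @poincare_cells R N (g i) (fun y => \int[lambda]_(x in @cell R N i) G2 (x, y)) N0
     (mg i) mIG2.
  rewrite /grid_integral.
  under [in X in _ -> X]eq_bigr => j _.
    rewrite -[`|_|%:E]/(`|(\int[lambda]_(y in _) _)%:E|) fineK; last first.
      by apply: integrable_fin_num; [exact: cell_measurable|exact: integrable_strip_integral].
    over.
  apply.
  - by move=> y; apply: integral_ge0.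
  - by move=> j; exact: integrable_strip_integral.
  - move=> j y y' jy jy'.
    rewrite -tonelli_swap//; last exact: cell_measurable.
    rewrite /g -RintegralB//; [|exact: integrable_section..].
    apply: (@le_trans _ _ (\int[lambda]_(x in @cell R N i) `|w (x, y) - w (x, y')|%:E)).
      rewrite EFin_normr_Rintegral//; last first.
      + exact: (integrableB mC (integrable_section mw wB i y N0)
          (integrable_section mw wB i y' N0)).
      apply: le_abse_integral => //.
      apply/measurable_EFinP; apply: measurable_funTS; apply: measurable_funB.
        exact: measurableT_comp mw (measurable_pair2 _).
      exact: measurableT_comp mw (measurable_pair2 _).
    apply: ge0_le_integral => //.
    + apply/measurable_EFinP; apply: measurable_funTS; apply: measurableT_comp => //.
      by apply: measurable_funB; exact: measurableT_comp mw (measurable_pair2 _).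
    + apply: measurable_funTS.
      by apply: (measurable_partial_integral _ mG2 G20).2; exact: cell_measurable.
    + by move=> x _; exact: osc2.
have mga i : measurable_fun [set: mR] (fun y => `|g i y|%:E).
  by apply/measurable_EFinP; exact: (measurableT_comp (@normr_measurable R setT) (mg i)).
have IG0 D y : 0 <= \int[lambda]_(x in D) G1 (x, y) by apply: integral_ge0.
have IG20 D y : 0 <= \int[lambda]_(x in D) G2 (x, y) by apply: integral_ge0.
have mIG2 i := (measurable_partial_integral (@cell_measurable R N i) mG2 G20).1.
apply: (@le_trans _ _ (\int[lambda]_(y in J)
    ((N%:R^-1)%:E * \int[lambda]_(x in J) G1 (x, y) + \sum_(i < N) `|g i y|%:E))).
  apply: ge0_le_integral => //.
  - by move=> y _; apply: integral_ge0.
  - apply: measurable_funTS; apply: (measurable_partial_integral mJ mwE _).1.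
    by move=> p; rewrite lee_fin.
  - apply: measurable_funTS; apply: emeasurable_funD.
      exact: measurable_funeM.
    exact: emeasurable_sum.
rewrite ge0_integralD//; last 4 first.
- by move=> y _; rewrite mule_ge0.
- by apply: measurable_funTS; exact: measurable_funeM.
- by move=> y _; apply: sume_ge0 => i _; rewrite lee_fin.
- by apply: measurable_funTS; exact: emeasurable_sum.
rewrite ge0_integralZl//; last exact: measurable_funTS.
rewrite ge0_integral_sum//; last by move=> i; exact: measurable_funTS.
have IIG1 : 0 <= \int[lambda]_(y in J) \int[lambda]_(x in J) G1 (x, y).
  by apply: integral_ge0.
have IIG2 : 0 <= \int[lambda]_(y in J) \int[lambda]_(x in J) G2 (x, y).
  by apply: integral_ge0.
rewrite [in leRHS](ge0_muleDr _ IIG1 IIG2).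
rewrite -addeA leeD2l//.
have -> : \int[lambda]_(y in J) \int[lambda]_(x in J) G2 (x, y) =
    \sum_(i < N) \int[lambda]_(y in J) \int[lambda]_(x in cell N i) G2 (x, y).
  rewrite -ge0_integral_sum//; last by move=> i; exact: measurable_funTS.
  apply: eq_integral => y _; rewrite (integral_cells N0)//.
  exact: measurableT_comp mG2 (measurable_pair2 _).
rewrite ge0_sume_distrr; last by move=> i _; apply: integral_ge0.
by rewrite -big_split/=; apply: lee_sum => i _; exact: sec2.
Qed.
End grid2.

(** * Continuously differentiable functions vanishing outside the square *)

Section c1.
Context {R : realType}.
Local Notation mR := (measurableTypeR R).
Local Notation lambda := (@lebesgue_measure R).

Lemma norm_increment_le_integral (f f' : R -> R) (x x' : R) : x <= x' ->
  continuous f' -> (forall t : R, is_derive t 1 f (f' t)) ->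
  (`|f x' - f x|%:E <= \int[lambda]_(t in `[x, x']) `|f' t|%:E)%E.
Proof.
rewrite le_eqVlt => /predU1P[<- _ _|xx' cf' df].
  by rewrite subrr normr0; apply: integral_ge0 => t _; rewrite lee_fin.
have cf : continuous f.
  move=> t; apply: differentiable_continuous; apply/derivable1_diffP.
  exact: ex_derive.
rewrite -[leLHS]/(`|(f x' - f x)%:E|)%E.
have <- : (\int[lambda]_(t in `[x, x']) (f' t)%:E = (f x' - f x)%:E)%E.
  rewrite EFinB; apply: continuous_FTC2 => //.
  - exact: continuous_subspaceT.
  - split.
    + by move=> t _; exact: ex_derive.
    + exact: cvg_at_right_filter (cf x).
    + exact: cvg_at_left_filter (cf x').
  - by move=> t _; rewrite derive1E derive_val.
apply: le_abse_integral => //.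
by apply/measurable_EFinP; apply: measurable_funTS; exact: continuous_measurable_fun.
Qed.

(** What is kept of a test function.  The partial derivatives are data, so that
    differences of test functions have theirs by mere subtraction. *)
Definition c1_on (f D1 D2 : R * R -> R) : Prop :=
  [/\ [/\ continuous f, continuous D1 & continuous D2],
      forall x y : R, is_derive x 1 (fun t => f (t, y)) (D1 (x, y)),
      forall x y : R, is_derive y 1 (fun t => f (x, t)) (D2 (x, y)) &
      forall p, ~ @Omega R p -> f p = 0].

Lemma is_derive_section1 (f : R * R -> R) (x y : R) :
  derivable f (x, y) (e1 R) ->
  is_derive x 1 (fun t => f (t, y)) ('D_(e1 R) f (x, y)).
Proof.
move=> df.
have E : (fun h : R => h^-1 *: ((f \o shift (x, y)) (h *: e1 R) - f (x, y))) =
   (fun h : R => h^-1 *: (((fun t => f (t, y)) \o shift x) (h *: 1) - f (x, y))).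
  apply/funext => h; congr (_ *: (f _ - _)).
  by rewrite /= /e1; congr pair; rewrite /= ?scaler0 ?add0r.
split; first by rewrite /derivable -E.
by rewrite /derive -E.
Qed.

Lemma is_derive_section2 (f : R * R -> R) (x y : R) :
  derivable f (x, y) (e2 R) ->
  is_derive y 1 (fun t => f (x, t)) ('D_(e2 R) f (x, y)).
Proof.
move=> df.
have E : (fun h : R => h^-1 *: ((f \o shift (x, y)) (h *: e2 R) - f (x, y))) =
   (fun h : R => h^-1 *: (((fun t => f (x, t)) \o shift y) (h *: 1) - f (x, y))).
  apply/funext => h; congr (_ *: (f _ - _)).
  by rewrite /= /e2; congr pair; rewrite /= ?scaler0 ?add0r.
split; first by rewrite /derivable -E.
by rewrite /derive -E.
Qed.

Lemma test_function_c1 (phi : R * R -> R) : test_function phi ->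
  c1_on phi ('D_(e1 R) phi) ('D_(e2 R) phi).
Proof.
move=> [Cphi _ supp].
have [cphi [d1 d2] [cD1 _ _ _] [cD2 _ _ _]] := Cphi 2.
split=> // [x y|x y|p Op].
- exact: is_derive_section1.
- exact: is_derive_section2.
- apply/eqP/negP => /negP phip; apply: Op; apply: supp.
  exact: subset_closure.
Qed.

Lemma continuous_bounded_Omega (f : R * R -> R) : continuous f ->
  exists M, forall p, @Omega R p -> `|f p| <= M.
Proof.
move=> cf.
have cK : compact (`[0 : R, 1] `*` `[0 : R, 1]).
  by apply: compact_setX; exact: segment_compact.
have /compact_bounded[M [_ bM]] : compact (f @` (`[0 : R, 1] `*` `[0 : R, 1])).
  apply: continuous_compact cK; exact: continuous_subspaceT.
exists (M + 1) => p [/= p1 p2]; apply: (bM (M + 1)); first by rewrite ltrDl.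
exists p => //; split => /=.
- by move: p1; rewrite !in_itv/= => /andP[/ltW -> /ltW ->].
- by move: p2; rewrite !in_itv/= => /andP[/ltW -> /ltW ->].
Qed.

Lemma c1_bounded (f D1 D2 : R * R -> R) : c1_on f D1 D2 ->
  exists M, forall p, `|f p| <= M.
Proof.
move=> [[cf _ _] _ _ f0]; have [M fM] := continuous_bounded_Omega cf.
exists `|M| => p; have [/fM h|/f0 ->] := pselect (@Omega R p).
  exact: le_trans h (ler_norm _).
by rewrite normr0.
Qed.

End c1.

(** * The critical estimate in L^4 *)

Section l4.
Context {R : realType}.
Local Notation mR := (measurableTypeR R).
Local Notation lambda := (@lebesgue_measure R).
Local Notation I := (`]0%R, 1%R[%classic : set R).

(** Cauchy-Schwarz for |f x| <= integral of |f'| over [0, x].  It is obtained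
    from 2 c |f'| <= f'^2 + c^2, integrated over [0, x], by optimizing c. *)
Lemma sqr_le_integral_sqr (f f' : R -> R) (x : R) : 0 < x < 1 ->
  continuous f' -> (forall t : R, is_derive t 1 f (f' t)) -> f 0 = 0 ->
  (((f x) ^+ 2)%:E <= x%:E * \int[lambda]_(t in I) (f' t ^+ 2)%:E)%E.
Proof.
move=> /andP[x0 x1] cf' df f0.
have mf' : measurable_fun [set: mR] f' by exact: continuous_measurable_fun.
have mf2 : measurable_fun [set: mR] (fun t => (f' t ^+ 2)%:E).
  by apply/measurable_EFinP; exact: measurable_funX.
have mJ : measurable (`[0 : R, x] : set mR) by exact: measurable_itv.
have lJ : lambda (`[0 : R, x] : set R) = x%:E.
  by rewrite lebesgue_measure_itv/= lte_fin x0 -EFinB subr0.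
set A := (\int[lambda]_(t in I) (f' t ^+ 2)%:E)%E.
have A0 : (0 <= A)%E by apply: integral_ge0 => t _; rewrite lee_fin sqr_ge0.
have JA : (\int[lambda]_(t in `[0%R, x]) (f' t ^+ 2)%:E <= A)%E.
  rewrite -integral_itv_obnd_cbnd; last exact: measurable_funTS.
  apply: ge0_subset_integral => //.
  - exact: measurable_funTS.
  - by move=> t _; rewrite lee_fin sqr_ge0.
  - move=> t /=; rewrite !in_itv/= => /andP[-> tx] /=; exact: le_lt_trans tx x1.
have H c : 0 < c -> ((2 * c * `|f x|)%:E <= A + (c ^+ 2 * x)%:E)%E.
  move=> c0; have c20 : 0 <= 2 * c by lra.
  have h1 := norm_increment_le_integral (ltW x0) cf' df; rewrite f0 subr0 in h1.
  rewrite EFinM; apply: le_trans (lee_wpmul2l _ h1) _; first by rewrite lee_fin.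
  rewrite -ge0_integralZl//; last first.
    by apply/measurable_EFinP; apply: measurable_funTS; exact: measurableT_comp.
  have <- : (\int[lambda]_(t in `[0%R, x]) (c ^+ 2)%:E = (c ^+ 2 * x)%:E)%E.
    transitivity ((c ^+ 2)%R%:E * lambda `[0%R, x]%classic)%E.
      exact: integral_cst.
    by rewrite lJ EFinM.
  apply: le_trans (leeD2r _ JA); rewrite -ge0_integralD//; last 3 first.
  - by move=> t _; rewrite lee_fin sqr_ge0.
  - exact: measurable_funTS.
  - by move=> t _; rewrite lee_fin sqr_ge0.
  apply: ge0_le_integral => //.
  - by move=> t _; rewrite -EFinM lee_fin mulr_ge0.
  - apply/measurable_EFinP; apply: measurable_funTS; apply: measurable_funM => //.
    exact: measurableT_comp.
  - apply: measurable_funTS; apply: emeasurable_funD => //.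
  - move=> t _; rewrite -EFinM -EFinD lee_fin -(real_normK (num_real (f' t))).
    by have := sqr_ge0 (`|f' t| - c); nra.
have [fx0|fx0] := eqVneq (f x) 0.
  by rewrite fx0 expr0n/= mule_ge0// lee_fin ltW.
have F0 : 0 < `|f x| by rewrite normr_gt0.
(* The value of c that makes 2 c |f x| - c^2 x maximal. *)
have := H (`|f x| / x) (divr_gt0 F0 x0).
case: A A0 {JA H} => [a| |] //= a0.
  rewrite -EFinD lee_fin -EFinM lee_fin -(real_normK (num_real (f x))) => h.
  have : `|f x| ^+ 2 / x <= a.
    have -> : `|f x| ^+ 2 / x = 2 * (`|f x| / x) * `|f x| - (`|f x| / x) ^+ 2 * x.
      by field; rewrite gt_eqF.
    by lra.
  by rewrite ler_pdivrMr// mulrC.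
by move=> _; rewrite gt0_muley ?lte_fin ?leey.
Qed.

(** Multiply both inequalities and divide by x y.  The infinite values of A and
    B, for which 0 * oo = 0, are the reason for the case analysis. *)
Lemma sqr_le_mul_of_scaled (x y s : R) (A B : \bar R) : 0 < x -> 0 < y -> 0 <= s ->
  ((y * s)%:E <= x%:E * A)%E -> ((x * s)%:E <= y%:E * B)%E ->
  ((s ^+ 2)%:E <= A * B)%E.
Proof.
move=> x0 y0 s0.
have [->|sn0] := eqVneq s 0.
  rewrite !mulr0 expr0n/= => hA hB.
  apply: mule_ge0; first by rewrite -(@pmule_rge0 _ x%:E) ?lte_fin.
  by rewrite -(@pmule_rge0 _ y%:E) ?lte_fin.
have {}s0 : 0 < s by rewrite lt_neqAle eq_sym sn0.
have ys0 : 0 < y * s by rewrite mulr_gt0.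
have xs0 : 0 < x * s by rewrite mulr_gt0.
case: A => [a| |]; last by rewrite gt0_muleNy ?lte_fin.
- case: B => [b| |]; last by rewrite gt0_muleNy ?lte_fin.
  + rewrite -!EFinM !lee_fin => hA hB.
    have h := ler_pM (ltW ys0) (ltW xs0) hA hB.
    by rewrite -(ler_pM2l (mulr_gt0 x0 y0)); lra.
  + rewrite -EFinM lee_fin => hA _.
    have a0 : 0 < a by rewrite -(pmulr_rgt0 _ x0); exact: lt_le_trans hA.
    by rewrite gt0_muley ?lte_fin// leey.
- move=> _ hB.
  have B0 : (0 < B)%E.
    rewrite -(@pmule_rgt0 _ y%:E) ?lte_fin//; apply: lt_le_trans hB.
    by rewrite lte_fin.
  by rewrite gt0_mulye// leey.
Qed.

Lemma measurable_weight_y (a : R) : measurable_fun [set: mR * mR] (weight_y a).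
Proof. exact: (measurableT_comp (measurable_powR a) measurable_snd). Qed.

Lemma measurable_weight_x (a : R) : measurable_fun [set: mR * mR] (weight_x a).
Proof. exact: (measurableT_comp (measurable_powR a) measurable_fst). Qed.

Lemma le_powR_sqr (a x : R) : 0 < x < 1 -> 0 < a < 2^-1 -> x <= (x `^ a) ^+ 2.
Proof.
move=> /andP[x0 x1] /andP[a0 a1].
rewrite -powR_mulrn ?powR_ge0// -powRrM -[leLHS](powRr1 (ltW x0)).
have x01 : 0 < x <= 1 by rewrite x0 ltW.
have a21 : a * 2 <= 1 by lra.
exact: (ger_powR x01 a21).
Qed.

Lemma continuous_section1 (g : R * R -> R) (y : R) :
  continuous g -> continuous (fun t => g (t, y)).
Proof.
move=> cg t; apply: (@continuous_comp _ _ _ (fun t => (t, y)) g); last exact: cg.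
exact: (cvg_pair cvg_id (cvg_cst _)).
Qed.

Lemma continuous_section2 (g : R * R -> R) (x : R) :
  continuous g -> continuous (fun t => g (x, t)).
Proof.
move=> cg t; apply: (@continuous_comp _ _ _ (fun t => (x, t)) g); last exact: cg.
exact: (cvg_pair (cvg_cst _) cvg_id).
Qed.

(** The critical estimate: phi(x, y)^4 <= A(y) B(x), where each factor depends
    on one variable only. *)
Lemma integral_expr4_le_energy (a1 a2 : R) (f D1 D2 : R * R -> R) :
  0 < a1 < 2^-1 -> 0 < a2 < 2^-1 -> c1_on f D1 D2 ->
  (\int[muO R]_p (f p ^+ 4)%:E <=
   \int[muO R]_p ((weight_y a1 p * D1 p) ^+ 2)%:E *
   \int[muO R]_p ((weight_x a2 p * D2 p) ^+ 2)%:E)%E.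
Proof.
move=> ha1 ha2 [[cf cD1 cD2] d1 d2 f0].
have mf := continuous_measurable_prod cf.
have mD1 := continuous_measurable_prod cD1.
have mD2 := continuous_measurable_prod cD2.
have m4 := measurable_EFinX 4 mf.
have m1 := measurable_EFinX 2 (measurable_funM (measurable_weight_y a1) mD1).
have m2 := measurable_EFinX 2 (measurable_funM (measurable_weight_x a2) mD2).
rewrite (integral_muO_yx m1); last by move=> p; rewrite lee_fin sqr_ge0.
rewrite (integral_muO_xy m2); last by move=> p; rewrite lee_fin sqr_ge0.
rewrite (integral_muO_xy m4); last by move=> p; rewrite lee_fin exprn_even_ge0.
set A := fun y => (\int[lambda]_(x in I) ((weight_y a1 (x, y) * D1 (x, y)) ^+ 2)%:E)%E.
set B := fun x => (\int[lambda]_(y in I) ((weight_x a2 (x, y) * D2 (x, y)) ^+ 2)%:E)%E.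
have A0 y : (0 <= A y)%E by apply: integral_ge0 => x _; rewrite lee_fin sqr_ge0.
have B0 x : (0 <= B x)%E by apply: integral_ge0 => y _; rewrite lee_fin sqr_ge0.
have mI : measurable (I : set mR) by exact: measurable_itv.
have mA : measurable_fun [set: mR] A.
  by apply: (measurable_partial_integral mI m1 _).1 => p; rewrite lee_fin sqr_ge0.
have mB : measurable_fun [set: mR] B.
  by apply: (measurable_partial_integral mI m2 _).2 => p; rewrite lee_fin sqr_ge0.
have key x y : I x -> I y -> ((f (x, y) ^+ 4)%:E <= A y * B x)%E.
  rewrite /= !in_itv/= => hx hy.
  have [x0 x1] := andP hx; have [y0 y1] := andP hy.
  rewrite (_ : f (x, y) ^+ 4 = (f (x, y) ^+ 2) ^+ 2); last by rewrite -exprM.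
  apply: (sqr_le_mul_of_scaled x0 y0); first exact: sqr_ge0.
  - have f00 : f (0, y) = 0 by apply: f0 => -[]/=; rewrite in_itv/= ltxx.
    have c1 : continuous (fun t => y `^ a1 * D1 (t, y)).
      move=> t; exact: (cvgM (cvg_cst _) (@continuous_section1 D1 y cD1 t)).
    have d1' (t : R) : is_derive t 1 (fun t => y `^ a1 * f (t, y)) (y `^ a1 * D1 (t, y)).
      exact: is_deriveZ.
    apply: le_trans (sqr_le_integral_sqr hx c1 d1' _); last by rewrite /= f00 mulr0.
    by rewrite exprMn lee_fin ler_wpM2r ?sqr_ge0// le_powR_sqr.
  - have f00 : f (x, 0) = 0 by apply: f0 => -[]/= _; rewrite in_itv/= ltxx.
    have c2 : continuous (fun t => x `^ a2 * D2 (x, t)).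
      move=> t; exact: (cvgM (cvg_cst _) (@continuous_section2 D2 x cD2 t)).
    have d2' (t : R) : is_derive t 1 (fun t => x `^ a2 * f (x, t)) (x `^ a2 * D2 (x, t)).
      exact: is_deriveZ.
    apply: le_trans (sqr_le_integral_sqr hy c2 d2' _); last by rewrite /= f00 mulr0.
    by rewrite exprMn lee_fin ler_wpM2r ?sqr_ge0// le_powR_sqr.
have IA0 : (0 <= \int[lambda]_(y in I) A y)%E by apply: integral_ge0.
rewrite -(ge0_integralZl _ mI (measurable_funTS mB) (fun x _ => B0 x) IA0).
apply: ge0_le_integral => //.
- by move=> x _; apply: integral_ge0 => y _; rewrite lee_fin exprn_even_ge0.
- apply: measurable_funTS; apply: (measurable_partial_integral mI m4 _).2.
  by move=> p; rewrite lee_fin exprn_even_ge0.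
- by apply: measurable_funTS; exact: measurable_funeM.
- move=> x Ix; rewrite -(ge0_integralZr _ mI (measurable_funTS mA) (fun y _ => A0 y) (B0 x)).
  apply: ge0_le_integral => //.
  + by move=> y _; rewrite lee_fin exprn_even_ge0.
  + apply: measurable_funTS; exact: measurableT_comp m4 (measurable_pair1 _).
  + by apply: measurable_funTS; apply: emeasurable_funM => //; exact: measurable_cst.
  + by move=> y Iy; exact: key.
Qed.
End l4.

(** * Integrability of the gradient *)

Section w11.
Context {R : realType}.
Local Notation mR := (measurableTypeR R).
Local Notation lambda := (@lebesgue_measure R).
Local Notation I := (`]0%R, 1%R[%classic : set R).

Lemma le_integral_muO (F G : mR * mR -> \bar R) :
  measurable_fun [set: mR * mR] F -> (forall p, 0 <= F p)%E ->
  measurable_fun [set: mR * mR] G -> (forall p, 0 <= G p)%E ->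
  (forall p, @Omega R p -> F p <= G p)%E ->
  (\int[muO R]_p F p <= \int[muO R]_p G p)%E.
Proof.
move=> mF F0 mG G0 FG.
have mO : measurable (@Omega R : set (mR * mR)) := @measurable_Omega R.
rewrite !integral_muOE//; apply: ge0_le_integral => //.
- by move=> p _; rewrite patchE; case: ifP.
- exact: measurable_funTS_restrict.
- exact: measurable_funTS_restrict.
- by move=> p _; rewrite !patchE; case: ifPn => // /set_mem/FG.
Qed.

(** The primitive y^(1-b) / (1-b) on [1/(n+2), 1], then monotone convergence in
    n, because the integrand is singular at 0. *)
Lemma integral_powRN_itv01_le (b : R) : 0 < b < 1 ->
  (\int[lambda]_(y in I) (y `^ (- b))%:E <= ((1 - b)^-1)%:E)%E.
Proof.
move=> /andP[b0 b1].
have b10 : 0 < 1 - b by lra.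
pose J n := `[n.+2%:R^-1, 1%R]%classic : set R.
have mp : measurable_fun [set: mR] (fun y : R => (y `^ (- b))%:E).
  by apply/measurable_EFinP; exact: measurable_powR.
have p0 (y : R) : (0 <= (y `^ (- b))%:E)%E by rewrite lee_fin powR_ge0.
have mJ n : measurable (J n : set mR) by exact: measurable_itv.
have ndJ : nondecreasing_seq J.
  move=> m n mn; apply/subsetPset => x /=; rewrite /J/= !in_itv/= => /andP[mx ->].
  rewrite andbT; apply: le_trans mx.
  by rewrite lef_pV2 ?posrE ?ltr0n// ler_nat.
have IJ : I `<=` \bigcup_n J n.
  move=> x /=; rewrite in_itv/= => /andP[x0 x1].
  exists (Num.truncn x^-1) => //; rewrite /J/= in_itv/= (ltW x1) andbT.
  rewrite -[leRHS]invrK lef_pV2 ?posrE ?invr_gt0 ?ltr0n//.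
  apply: le_trans (ltW (truncnS_gt _)) _.
  by rewrite ler_nat.
apply: (@le_trans _ _ (\int[lambda]_(y in \bigcup_n J n) (y `^ (- b))%:E)%E).
  apply: ge0_subset_integral => //.
  - exact: bigcup_measurable.
  - exact: measurable_funTS.
have := @ge0_nondecreasing_set_cvg_integral _ mR R J (fun y : R => (y `^ (- b))%:E) lambda
  ndJ mJ (fun i => measurable_funTS mp) (fun _ _ _ => p0 _).
move=> h; rewrite -(cvg_lim _ h)//; apply: lime_le; first by apply/cvg_ex; eexists; exact: h.
apply: nearW => n; rewrite /J.
set d := n.+2%:R^-1.
have d0 : 0 < d by rewrite invr_gt0 ltr0n.
have d1 : d < 1 by rewrite invf_lt1 ?ltr0n// ltr1n.
pose F (y : R) := (1 - b)^-1 * y `^ (1 - b).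
have dF (y : R) : 0 < y -> is_derive y 1 F (y `^ (- b)).
  move=> y0; have -> : y `^ (- b) = (1 - b)^-1 * ((1 - b) * y `^ ((1 - b) - 1)).
    rewrite mulrA mulVf ?gt_eqF// mul1r; congr (_ `^ _); lra.
  by apply: is_deriveZ; exact: is_derive1_powR.
have cF (y : R) : 0 < y -> {for y, continuous F}.
  move=> y0; apply: differentiable_continuous; apply/derivable1_diffP.
  by have [] := dF y y0.
rewrite (@continuous_FTC2 _ _ F)//.
- rewrite -EFinB lee_fin /F powR1 mulr1 gerBl.
  by rewrite mulr_ge0 ?powR_ge0// invr_ge0 ltW.
- apply: derivable_within_continuous => y; rewrite in_itv/= => /andP[dy _].
  by apply: derivable_powR; rewrite in_itv/= andbT (lt_le_trans d0).
- split.
  + move=> y; rewrite in_itv/= => /andP[dy _].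
    by have [] := dF y (lt_trans d0 dy).
  + exact: cvg_at_right_filter (cF _ d0).
  + exact: cvg_at_left_filter (cF _ ltr01).
- move=> y; rewrite in_itv/= => /andP[dy _].
  have y0 := lt_trans d0 dy.
  by rewrite derive1E; have [_ ->] := dF y y0.
Qed.

(** |d| is the product of y^(-a) and |y^a d|, and s t <= s^2 + t^2. *)
Lemma norm_le_powR_sqr (a y d : R) : 0 < y ->
  `|d| <= y `^ (- (2 * a)) + (y `^ a * d) ^+ 2.
Proof.
move=> y0; have s0 : 0 < y `^ a by exact: powR_gt0.
rewrite powRN mulrC powRrM (powR_mulrn 2) ?powR_ge0//.
set s := y `^ a in s0 *.
have -> : `|d| = s^-1 * (s * `|d|) by rewrite mulrA mulVf ?gt_eqF// mul1r.
have -> : (s * d) ^+ 2 = (s * `|d|) ^+ 2.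
  by rewrite !exprMn (real_normK (num_real d)).
rewrite -exprVn.
have := sqr_ge0 (s^-1 - s * `|d|).
have : 0 <= s^-1 * (s * `|d|).
  by apply: mulr_ge0; [rewrite invr_ge0; exact: ltW|apply: mulr_ge0 => //; exact: ltW].
by nra.
Qed.

(** Stated for a function c, which stands for either coordinate. *)
Lemma L1_le_weighted_sqr (a : R) (c : mR * mR -> mR) (D : R * R -> R) :
  measurable_fun [set: mR * mR] c -> (forall p, @Omega R p -> 0 < c p) ->
  continuous D ->
  (\int[muO R]_p `|D p|%:E <= \int[muO R]_p (c p `^ (- (2 * a)))%:E +
     \int[muO R]_p ((c p `^ a * D p) ^+ 2)%:E)%E.
Proof.
move=> mc c0 cD.
have mD := continuous_measurable_prod cD.
have mca b : measurable_fun [set: mR * mR] (fun p => c p `^ b).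
  exact: (measurableT_comp (measurable_powR _) mc).
have m1 := measurable_EFinX 2 (measurable_funM (mca a) mD).
have mw : measurable_fun [set: mR * mR] (fun p => (c p `^ (- (2 * a)))%:E).
  exact/measurable_EFinP.
have w0 p : (0 <= (c p `^ (- (2 * a)))%:E)%E by rewrite lee_fin powR_ge0.
have s0 p : (0 <= ((c p `^ a * D p) ^+ 2)%:E)%E by rewrite lee_fin sqr_ge0.
rewrite -ge0_integralD//; apply: le_integral_muO.
- by apply/measurable_EFinP; exact: measurableT_comp.
- by move=> p; rewrite lee_fin.
- exact: emeasurable_funD.
- by move=> p; rewrite adde_ge0.
- by move=> p /c0 cp; rewrite -EFinD lee_fin norm_le_powR_sqr.
Qed.

Lemma integral_itv01_cst (k : R) : (\int[lambda]_(x in I) k%:E = k%:E)%E.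
Proof.
have I1 : lambda I = 1%E.
  by rewrite lebesgue_measure_itv/= lte_fin ltr01 -EFinB subr0.
transitivity (k%:E * lambda I)%E; last by rewrite I1 mule1.
exact: integral_cst.
Qed.

Lemma L1_derivative_bound1 (a : R) (D : R * R -> R) :
  0 < a < 2^-1 -> continuous D ->
  (\int[muO R]_p `|D p|%:E <= ((1 - 2 * a)^-1)%:E +
     \int[muO R]_p ((weight_y a p * D p) ^+ 2)%:E)%E.
Proof.
move=> /andP[a0 a1] cD.
apply: le_trans (L1_le_weighted_sqr a measurable_snd _ cD) _.
  by move=> [x y] [/= _]; rewrite in_itv/= => /andP[].
have mw : measurable_fun [set: mR * mR] (fun p : mR * mR => (p.2 `^ (- (2 * a)))%:E).
  by apply/measurable_EFinP; exact: (measurableT_comp (measurable_powR _) measurable_snd).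
apply: leeD2r; rewrite integral_muO_xy//=; last by move=> p; rewrite lee_fin powR_ge0.
rewrite -[leRHS]integral_itv01_cst; apply: ge0_le_integral => //.
- by move=> x _; apply: integral_ge0 => y _; rewrite lee_fin powR_ge0.
- by move=> x _; apply: integral_powRN_itv01_le; lra.
Qed.

Lemma L1_derivative_bound2 (a : R) (D : R * R -> R) :
  0 < a < 2^-1 -> continuous D ->
  (\int[muO R]_p `|D p|%:E <= ((1 - 2 * a)^-1)%:E +
     \int[muO R]_p ((weight_x a p * D p) ^+ 2)%:E)%E.
Proof.
move=> /andP[a0 a1] cD.
apply: le_trans (L1_le_weighted_sqr a measurable_fst _ cD) _.
  by move=> [x y] [/=]; rewrite in_itv/= => /andP[].
have mw : measurable_fun [set: mR * mR] (fun p : mR * mR => (p.1 `^ (- (2 * a)))%:E).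
  by apply/measurable_EFinP; exact: (measurableT_comp (measurable_powR _) measurable_fst).
apply: leeD2r; rewrite integral_muO_yx//=; last by move=> p; rewrite lee_fin powR_ge0.
rewrite -[leRHS]integral_itv01_cst; apply: ge0_le_integral => //.
- by move=> x _; apply: integral_ge0 => y _; rewrite lee_fin powR_ge0.
- by move=> x _; apply: integral_powRN_itv01_le; lra.
Qed.
End w11.

(** * Distances in L^1 and integrals over the cells *)

Section poincare.
Context {R : realType}.
Local Notation mR := (measurableTypeR R).
Local Notation lambda := (@lebesgue_measure R).
Local Notation I := (`]0%R, 1%R[%classic : set R).
Local Notation J := (`[0%R, 1%R[%classic : set R).

Lemma cell_osc (N i : nat) (f f' : R -> R) (x x' : R) :
  continuous f' -> (forall t : R, is_derive t 1 f (f' t)) ->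
  cell N i x -> cell N i x' ->
  (`|f x - f x'|%:E <= \int[lambda]_(t in @cell R N i) `|f' t|%:E)%E.
Proof.
move=> cf' df; wlog xx' : x x' / x' <= x => [hw cx cx'|cx cx'].
  have [|/ltW] := leP x' x; first by move=> h; exact: hw.
  by move=> h; rewrite distrC; exact: hw.
apply: le_trans (norm_increment_le_integral xx' cf' df) _.
apply: ge0_subset_integral => //.
- exact: measurable_itv.
- apply/measurable_EFinP; apply: measurable_funTS; apply: measurableT_comp => //.
  exact: continuous_measurable_fun.
- move: cx cx'; rewrite /cell/= !in_itv/= => /andP[_ h1] /andP[h2 _] t /=.
  rewrite !in_itv/= => /andP[h3 h4].
  by rewrite (le_trans h2 h3) (le_lt_trans h4 h1).
Qed.

Lemma integral_muO_half_open (F : mR * mR -> \bar R) :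
  measurable_fun [set: mR * mR] F -> (forall p, 0 <= F p)%E ->
  (\int[muO R]_p F p = \int[lambda]_(y in J) \int[lambda]_(x in J) F (x, y))%E.
Proof.
move=> mF F0; apply: etrans (integral_muO_yx mF F0) _.
have mI : measurable (I : set mR) by exact: measurable_itv.
rewrite integral_itv_obnd_cbnd; last first.
  by apply: measurable_funTS; exact: (measurable_partial_integral mI mF F0).1.
apply: eq_integral => y _; rewrite integral_itv_obnd_cbnd//.
by apply: measurable_funTS; exact: measurableT_comp mF (measurable_pair2 _).
Qed.

Lemma L1_le_grid (N : nat) (w D1 D2 : R * R -> R) : (0 < N)%N ->
  c1_on w D1 D2 ->
  (\int[muO R]_p `|w p|%:E <=
   (N%:R^-1)%:E * (\int[muO R]_p `|D1 p|%:E + \int[muO R]_p `|D2 p|%:E) +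
   \sum_(i < N) \sum_(j < N) `|grid_integral N i j w|%:E)%E.
Proof.
move=> N0 c1w; have [B wB] := c1_bounded c1w.
have [[cw cD1 cD2] d1 d2 w0] := c1w.
have mabs (g : R * R -> R) : continuous g ->
    measurable_fun [set: mR * mR] (fun p => `|g p|%:E).
  move=> cg; apply/measurable_EFinP; apply: measurableT_comp => //.
  exact: continuous_measurable_prod.
have abs0 (g : R * R -> R) p : (0 <= `|g p|%:E)%E by rewrite lee_fin.
rewrite !integral_muO_half_open//; try exact: mabs.
apply: (poincare_grid N0 (continuous_measurable_prod cw) wB
  (mabs _ cD1) (abs0 _) (mabs _ cD2) (abs0 _)).
- move=> y i x x' cx cx';
  apply: (cell_osc (f := fun t => w (t, y)) (f' := fun t => D1 (t, y))) => //.
  exact: continuous_section1.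
- move=> x j y y' cy cy';
  apply: (cell_osc (f := fun t => w (x, t)) (f' := fun t => D2 (x, t))) => //.
  exact: continuous_section2.
Qed.

Lemma c1_onB (f D1 D2 g E1 E2 : R * R -> R) : c1_on f D1 D2 -> c1_on g E1 E2 ->
  c1_on (fun p => f p - g p) (fun p => D1 p - E1 p) (fun p => D2 p - E2 p).
Proof.
move=> [[cf cD1 cD2] d1 d2 f0] [[cg cE1 cE2] e1 e2 g0]; split.
- split=> p; apply: cvgB.
  + exact: cf.
  + exact: cg.
  + exact: cD1.
  + exact: cE1.
  + exact: cD2.
  + exact: cE2.
- move=> x y; exact: is_deriveB.
- move=> x y; exact: is_deriveB.
- by move=> p Op; rewrite f0// g0// subrr.
Qed.

(** The energies only enter through their bound M, so that the first term goes
    to 0 with 1/N uniformly on bounded sets of functions. *)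
Lemma L1_dist_le_grid (a1 a2 M : R) (N : nat) (f D1 D2 g E1 E2 : R * R -> R) :
  0 < a1 < 2^-1 -> 0 < a2 < 2^-1 -> (0 < N)%N ->
  c1_on f D1 D2 -> c1_on g E1 E2 ->
  (\int[muO R]_p ((weight_y a1 p * D1 p) ^+ 2)%:E <= M%:E)%E ->
  (\int[muO R]_p ((weight_x a2 p * D2 p) ^+ 2)%:E <= M%:E)%E ->
  (\int[muO R]_p ((weight_y a1 p * E1 p) ^+ 2)%:E <= M%:E)%E ->
  (\int[muO R]_p ((weight_x a2 p * E2 p) ^+ 2)%:E <= M%:E)%E ->
  (\int[muO R]_p `|f p - g p|%:E <=
   (N%:R^-1 * (2 * ((1 - 2 * a1)^-1 + M) + 2 * ((1 - 2 * a2)^-1 + M)) +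
   \sum_(i < N) \sum_(j < N) `|grid_integral N i j f - grid_integral N i j g|)%:E)%E.
Proof.
move=> ha1 ha2 N0 c1f c1g D1M D2M E1M E2M.
have [[cf cD1 cD2] _ _ _] := c1f; have [[cg cE1 cE2] _ _ _] := c1g.
have [Bf fB] := c1_bounded c1f; have [Bg gB] := c1_bounded c1g.
have gridB i j := grid_integralB i j N0 (continuous_measurable_prod cf) fB
  (continuous_measurable_prod cg) gB.
apply: le_trans (L1_le_grid N0 (c1_onB c1f c1g)) _.
rewrite EFinD; apply: leeD; last first.
  rewrite -sumEFin; apply: lee_sum => i _; rewrite -sumEFin; apply: lee_sum => j _.
  by rewrite gridB.
rewrite EFinM; apply: lee_wpmul2l; first by rewrite lee_fin invr_ge0.
rewrite EFinD; apply: leeD.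
- apply: le_trans (integral_normB_le (muO R)
    (continuous_measurable_prod cD1) (continuous_measurable_prod cE1)) _.
  rewrite mulr_natl mulr2n EFinD; apply: leeD.
    apply: le_trans (L1_derivative_bound1 ha1 cD1) _.
    by rewrite EFinD leeD2l.
  apply: le_trans (L1_derivative_bound1 ha1 cE1) _.
  by rewrite EFinD leeD2l.
- apply: le_trans (integral_normB_le (muO R)
    (continuous_measurable_prod cD2) (continuous_measurable_prod cE2)) _.
  rewrite mulr_natl mulr2n EFinD; apply: leeD.
    apply: le_trans (L1_derivative_bound2 ha2 cD2) _.
    by rewrite EFinD leeD2l.
  apply: le_trans (L1_derivative_bound2 ha2 cE2) _.
  by rewrite EFinD leeD2l.
Qed.

Lemma grid_integral_le_L1 (N : nat) (i j : 'I_N) (f D1 D2 : R * R -> R) :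
  c1_on f D1 D2 -> (`|grid_integral N i j f|%:E <= \int[muO R]_p `|f p|%:E)%E.
Proof.
move=> c1f; have N0 : (0 < N)%N by apply: leq_ltn_trans (ltn_ord i).
have [B fB] := c1_bounded c1f; have [[cf _ _] _ _ _] := c1f.
have mf := continuous_measurable_prod cf.
have mC k := @cell_measurable R N k.
have subJ (k : 'I_N) : @cell R N k `<=` J.
  move=> t; rewrite /cell/= !in_itv/= => /andP[h1 h2]; apply/andP; split.
    by apply: le_trans h1; rewrite divr_ge0.
  by apply: lt_le_trans h2 _; rewrite ler_pdivrMr ?ltr0n// mul1r ler_nat.
have mfE : measurable_fun [set: mR * mR] (fun p => `|f p|%:E).
  by apply/measurable_EFinP; apply: measurableT_comp.
have f0 p : (0 <= `|f p|%:E)%E by rewrite lee_fin.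
have mJ : measurable (J : set mR) by exact: measurable_itv.
rewrite integral_muO_half_open// /grid_integral.
have mI := (measurable_partial_integral (mC i) mfE f0).1.
have mIJ := (measurable_partial_integral mJ mfE f0).1.
rewrite EFin_normr_Rintegral//; last exact: (integrable_strip_integral mf fB).
apply: le_trans (le_abse_integral _ _ _) _ => //.
  apply/measurable_EFinP; apply: measurable_funTS.
  exact: (measurable_strip_integral mf fB).
apply: (@le_trans _ _ (\int[lambda]_(y in @cell R N j)
    \int[lambda]_(x in @cell R N i) `|f (x, y)|%:E)%E).
  apply: ge0_le_integral => //.
  - apply: measurable_funTS; apply: measurableT_comp => //.
    apply/measurable_EFinP; exact: (measurable_strip_integral mf fB).
  - exact: measurable_funTS.
  - move=> y _.
    rewrite -[leLHS]/(`|\int[lambda]_(x in @cell R N i) f (x, y)|%:E).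
    rewrite EFin_normr_Rintegral//; last exact: (integrable_section mf fB).
    apply: le_abse_integral => //.
    apply/measurable_EFinP; apply: measurable_funTS.
    exact: measurableT_comp mf (measurable_pair2 _).
apply: (@le_trans _ _ (\int[lambda]_(y in J)
    \int[lambda]_(x in @cell R N i) `|f (x, y)|%:E)%E).
  apply: ge0_subset_integral => //.
  - exact: measurable_funTS.
  - by move=> y _; apply: integral_ge0.
apply: ge0_le_integral => //.
- by move=> y _; apply: integral_ge0.
- exact: measurable_funTS.
- exact: measurable_funTS.
- move=> y _; apply: ge0_subset_integral => //.
  apply: measurable_funTS; exact: measurableT_comp mfE (measurable_pair2 _).
Qed.
End poincare.

(** * Approximation of elements of H^1_0 by test functions *)

Section lfun.
Context d (T : measurableType d) (R : realType) (mu : {measure set T -> \bar R}).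
Local Open Scope ereal_scope.

Lemma Lfun_measurable (f : T -> R) p : f \in Lfun mu p -> measurable_fun setT f.
Proof. by rewrite inE => /andP[+ _]; rewrite inE. Qed.

Lemma Lfun_lty (f : T -> R) p : f \in Lfun mu p -> 'N[mu]_p[EFin \o f] < +oo.
Proof. by rewrite inE => /andP[_]; rewrite inE. Qed.

Lemma mem_Lfun (f : T -> R) p : measurable_fun setT f ->
  'N[mu]_p[EFin \o f] < +oo -> f \in Lfun mu p.
Proof. by move=> mf f_oo; rewrite inE; apply/andP; rewrite !inE. Qed.

Lemma poweR_Lnorm_EFin (f : T -> R) (r : R) : (0 < r)%R ->
  'N[mu]_r%:E[EFin \o f] `^ r = \int[mu]_x (`|f x| `^ r)%:E.
Proof. by move=> r0; rewrite poweR_Lnorm// gt_eqF. Qed.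

(** Removes the extended-real roots from bounds on norms; all the estimates are
    carried out on integrals of powers. *)
Lemma Lnorm_le (f : T -> R) (r c : R) : (0 < r)%R -> (0 <= c)%R ->
  ('N[mu]_r%:E[EFin \o f] <= c%:E) = (\int[mu]_x (`|f x| `^ r)%:E <= (c `^ r)%:E).
Proof.
move=> r0 c0; rewrite -poweR_Lnorm_EFin//.
have := Lnorm_ge0 mu r%:E (EFin \o f); case: ('N[mu]_r%:E[EFin \o f]) => [s| |]//.
  rewrite -poweR_EFin !lee_fin => s0; apply/idP/idP => [|].
    by apply: ge0_ler_powR; rewrite ?nnegrE// ltW.
  by apply: contraTT; rewrite -!ltNge; apply: gt0_ltr_powR; rewrite ?nnegrE.
by move=> _; rewrite /= gt_eqF// !leye_eq.
Qed.

Lemma Lnorm_lty (f : T -> R) (r : R) : (0 < r)%R ->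
  ('N[mu]_r%:E[EFin \o f] < +oo) = (\int[mu]_x (`|f x| `^ r)%:E < +oo).
Proof.
move=> r0; rewrite -poweR_Lnorm_EFin//.
have := Lnorm_ge0 mu r%:E (EFin \o f); case: ('N[mu]_r%:E[EFin \o f]) => [s| |]//.
  by move=> _; rewrite /= !ltry.
by move=> _; rewrite /= gt_eqF.
Qed.

Lemma Lnorm2_le (f : T -> R) (c : R) : (0 <= c)%R ->
  ('N[mu]_2%:E[EFin \o f] <= c%:E) = (\int[mu]_x (f x ^+ 2)%:E <= (c ^+ 2)%:E).
Proof.
move=> c0; rewrite Lnorm_le// powR_mulrn//; congr (_ <= _).
by apply: eq_integral => x _; rewrite powR_mulrn// real_normK ?num_real.
Qed.

Lemma L1_le_L2 (f : T -> R) : mu setT = 1 -> measurable_fun setT f ->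
  \int[mu]_x `|f x|%:E <= 'N[mu]_2%:E[EFin \o f].
Proof.
move=> mu1 mf.
have := @hoelder _ T R mu f (cst 1%R) 2 2 mf (measurable_cst _) _ _ _.
rewrite (_ : EFin \o (f \* cst 1)%R = EFin \o f); last first.
  by apply/funext => x /=; rewrite mulr1.
rewrite (_ : EFin \o cst 1%R = cst 1)// Lnorm_cst1 mu1 Lnorm1 poweR1r mule1.
by apply => //; rewrite [RHS]splitr !div1r.
Qed.

End lfun.

Section approximation.
Context {R : realType}.
Local Notation mR := (measurableTypeR R).

Lemma bounded_Lfun2 (f : R * R -> R) (M : R) : measurable_fun [set: mR * mR] f ->
  (forall p, @Omega R p -> `|f p| <= M) -> f \in Lfun (muO R) 2%:E.
Proof.
move=> mf fM; apply: mem_Lfun => //; rewrite Lnorm_lty//.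
apply: (@le_lt_trans _ _ (\int[muO R]_p (`|M| `^ 2)%:E)%E).
  apply: le_integral_muO.
  - apply/measurable_EFinP; apply: (measurableT_comp (measurable_powR _)).
    exact: measurableT_comp.
  - by move=> p; rewrite lee_fin powR_ge0.
  - exact: measurable_cst.
  - by move=> p; rewrite lee_fin powR_ge0.
  - move=> p /fM pM; rewrite lee_fin; apply: ge0_ler_powR; rewrite ?nnegrE//.
    exact: le_trans pM (ler_norm _).
by rewrite integral_cst// muO_setT mule1 ltry.
Qed.

Lemma Lfun2B (f g : R * R -> R) : f \in Lfun (muO R) 2%:E ->
  g \in Lfun (muO R) 2%:E -> (fun p => f p - g p) \in Lfun (muO R) 2%:E.
Proof.
move=> fL gL; have p1 : (1 <= 2%:E :> \bar R)%E by rewrite lee_fin ler1n.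
have [_ addL] := Lfun_addr_closed (muO R) p1.
exact: (addL f (- g) fL (Lfun_oppr_closed gL)).
Qed.

Lemma L2norm_ge0 (f : R * R -> R) : 0 <= L2norm f.
Proof. by apply: fine_ge0; exact: Lnorm_ge0. Qed.

Lemma L2normE (f : R * R -> R) : f \in Lfun (muO R) 2%:E ->
  ('N[muO R]_2%:E[EFin \o f])%E = (L2norm f)%:E.
Proof. by move=> fL; rewrite fineK// ge0_fin_numE ?Lnorm_ge0//; exact: Lfun_lty. Qed.

Lemma L2norm_le_graph_norm (f g h : R * R -> R) :
  [/\ L2norm f <= graph_norm f g h, L2norm g <= graph_norm f g h &
      L2norm h <= graph_norm f g h].
Proof.
have f0 := L2norm_ge0 f; have g0 := L2norm_ge0 g; have h0 := L2norm_ge0 h.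
have f1 := sqr_ge0 (L2norm f); have g1 := sqr_ge0 (L2norm g); have h1 := sqr_ge0 (L2norm h).
have H a : 0 <= a -> a ^+ 2 <= L2norm f ^+ 2 + L2norm g ^+ 2 + L2norm h ^+ 2 ->
    a <= graph_norm f g h.
  move=> a0 ale; rewrite -(ger0_norm a0) -sqrtr_sqr; exact: ler_wsqrtr.
by split; apply: H => //; lra.
Qed.

(** The triangle inequality g = f + (g - f) in L^2. *)
Lemma integral_sqr_approx (f g : R * R -> R) (K eps : R) : 0 <= K + eps ->
  f \in Lfun (muO R) 2%:E -> g \in Lfun (muO R) 2%:E ->
  L2norm f <= K -> L2norm (fun p => f p - g p) <= eps ->
  (\int[muO R]_p (g p ^+ 2)%:E <= ((K + eps) ^+ 2)%:E)%E.
Proof.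
move=> K0 fL gL fK fge; rewrite -Lnorm2_le//.
have mf := Lfun_measurable fL; have mg := Lfun_measurable gL.
have := @minkowski_EFin _ _ R (muO R) f (fun p => g p - f p) 2 mf (measurable_funB mg mf) _.
rewrite (_ : (f \+ (fun p => g p - f p))%R = g); last first.
  by apply/funext => p /=; rewrite addrC subrK.
move=> /(_ (ler1n _ 2)) /le_trans; apply.
rewrite (EFinD K eps); apply: leeD; first by rewrite L2normE// lee_fin.
rewrite (_ : EFin \o (fun p => g p - f p) = (\- (EFin \o (fun p => (f p - g p)%R)))%E).
  by rewrite oppe_Lnorm L2normE ?lee_fin//; exact: Lfun2B.
by apply/funext => p /=; rewrite opprB.
Qed.

Lemma weight_y_le1 (a : R) p : 0 <= a -> @Omega R p -> 0 <= weight_y a p <= 1.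
Proof.
move=> a0 [_]; rewrite /= in_itv/= => /andP[y0 y1]; rewrite powR_ge0/=.
by apply: (le_trans (ge0_ler_powR a0 _ _ (ltW y1))); rewrite ?nnegrE ?powR1// ltW.
Qed.

Lemma weight_x_le1 (a : R) p : 0 <= a -> @Omega R p -> 0 <= weight_x a p <= 1.
Proof.
move=> a0 []; rewrite /= in_itv/= => /andP[y0 y1] _; rewrite powR_ge0/=.
by apply: (le_trans (ge0_ler_powR a0 _ _ (ltW y1))); rewrite ?nnegrE ?powR1// ltW.
Qed.

Lemma weighted_Lfun2 (w D : R * R -> R) : measurable_fun [set: mR * mR] w ->
  (forall p, @Omega R p -> 0 <= w p <= 1) -> continuous D ->
  (fun p => w p * D p) \in Lfun (muO R) 2%:E.
Proof.
move=> mw w1 cD; have [M DM] := continuous_bounded_Omega cD.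
apply: (@bounded_Lfun2 _ M).
  by apply: measurable_funM => //; exact: continuous_measurable_prod.
move=> p Op; have /andP[w0 wl1] := w1 p Op; have := DM p Op.
by rewrite normrM (ger0_norm w0); apply: le_trans; rewrite ler_piMl.
Qed.

(** The three terms of the graph norm of u - phi are at most eps; the first one
    is weakened to an L^1 norm, since the square has measure 1. *)
Lemma H10_approx (a1 a2 eps : R) (u : H1 a1 a2) :
  0 < a1 -> 0 < a2 -> 0 < eps -> @H10 R a1 a2 u ->
  exists phi D1 D2 : R * R -> R,
  [/\ c1_on phi D1 D2,
      (\int[muO R]_p `|u p - phi p|%:E <= eps%:E)%E,
      (\int[muO R]_p ((weight_y a1 p * D1 p) ^+ 2)%:E <= ((H1norm u + eps) ^+ 2)%:E)%E &
      (\int[muO R]_p ((weight_x a2 p * D2 p) ^+ 2)%:E <= ((H1norm u + eps) ^+ 2)%:E)%E].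
Proof.
move=> a10 a20 e0 Hu; have [phi tphi dist] := Hu _ e0.
have c1phi := test_function_c1 tphi; have [[cphi cD1 cD2] _ _ _] := c1phi.
exists phi, ('D_(e1 R) phi), ('D_(e2 R) phi).
have phiL : phi \in Lfun (muO R) 2%:E.
  have [M pM] := continuous_bounded_Omega cphi.
  by apply: bounded_Lfun2 pM; exact: continuous_measurable_prod.
have D1L := weighted_Lfun2 (measurable_weight_y a1) (fun p => @weight_y_le1 a1 p (ltW a10)) cD1.
have D2L := weighted_Lfun2 (measurable_weight_x a2) (fun p => @weight_x_le1 a2 p (ltW a20)) cD2.
have [_ K1 K2] := L2norm_le_graph_norm u (wdx u) (wdy u).
have [d0 d1 d2] := L2norm_le_graph_norm (fun p => u p - phi p)
    (fun p => wdx u p - weight_y a1 p * 'D_(e1 R) phi p)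
    (fun p => wdy u p - weight_x a2 p * 'D_(e2 R) phi p).
have Ke0 : 0 <= H1norm u + eps by rewrite addr_ge0 ?sqrtr_ge0// ltW.
split=> //.
- have uL := Lfun2B (H1fun_L2 u) phiL.
  apply: le_trans (L1_le_L2 (@muO_setT R) (Lfun_measurable uL)) _.
  by rewrite L2normE// lee_fin (le_trans d0 (ltW dist)).
- exact: (integral_sqr_approx Ke0 (wdx_L2 u) D1L K1 (le_trans d1 (ltW dist))).
- exact: (integral_sqr_approx Ke0 (wdy_L2 u) D2L K2 (le_trans d2 (ltW dist))).
Qed.

End approximation.

(** * The continuous embedding *)

Section embedding.
Context {R : realType}.
Local Notation mR := (measurableTypeR R).

(** Approximate u by test functions phi k whose energy stays below t^2 and whose
    L^1 distance to u is at most 2^-(k+1).  They converge to u almost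
    everywhere, and the bound in L^4 passes to the limit by Fatou. *)
Lemma integral_expr4_H10_le (a1 a2 t : R) (u : H1 a1 a2) : 0 < a1 < 2^-1 -> 0 < a2 < 2^-1 ->
  @H10 R a1 a2 u -> H1norm u < t ->
  (\int[muO R]_p (u p ^+ 4)%:E <= (t ^+ 4)%:E)%E.
Proof.
move=> ha1 ha2 Hu Kt.
have K0 : 0 <= H1norm u by exact: sqrtr_ge0.
have [a10 _] := andP ha1; have [a20 _] := andP ha2.
(* The first term keeps the energy below t^2, the second gives summability. *)
pose eps (k : nat) : R := Num.min (t - H1norm u) (1 / (2 ^ k.+1)%:R).
have eps0 k : 0 < eps k by rewrite lt_min subr_gt0 Kt divr_gt0// ltr0n expn_gt0.
have /choice[phi phiP] : forall k, exists phi, exists D1 D2 : R * R -> R,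
  [/\ c1_on phi D1 D2,
      (\int[muO R]_p `|u p - phi p|%:E <= (eps k)%:E)%E,
      (\int[muO R]_p ((weight_y a1 p * D1 p) ^+ 2)%:E <= ((H1norm u + eps k) ^+ 2)%:E)%E &
      (\int[muO R]_p ((weight_x a2 p * D2 p) ^+ 2)%:E <= ((H1norm u + eps k) ^+ 2)%:E)%E].
  by move=> k; exact: H10_approx a10 a20 (eps0 k) Hu.
have meas_u := Lfun_measurable (H1fun_L2 u).
have mphi k : measurable_fun [set: mR * mR] (phi k).
  have [D1 [D2 [[[cphi _ _] _ _ _] _ _ _]]] := phiP k.
  exact: continuous_measurable_prod.
have phi_u : {ae muO R, forall p, phi k p @[k --> \oo] --> u p}.
  apply: ae_cvg_L1 => // k; have [D1 [D2 [_ h _ _]]] := phiP k.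
  by apply: le_trans h _; rewrite lee_fin ge_min lexx orbT.
apply: (@integral_comp_le_ae_limit _ _ _ (muO R) (fun r => r ^+ 4) phi) => //.
- exact: exprn_continuous.
- by move=> r; rewrite exprn_even_ge0.
- apply: nearW => k.
  have [D1 [D2 [c1 _ h1 h2]]] := phiP k.
  apply: le_trans (integral_expr4_le_energy ha1 ha2 c1) _.
  have Kek : 0 <= H1norm u + eps k by rewrite addr_ge0// ltW.
  apply: le_trans (lee_pmul _ _ h1 h2) _.
  - by apply: integral_ge0 => p _; rewrite lee_fin sqr_ge0.
  - by apply: integral_ge0 => p _; rewrite lee_fin sqr_ge0.
  - rewrite -EFinM lee_fin -exprD; apply: lerXn2r; rewrite ?nnegrE//.
      exact: le_trans (ltW Kt).
    by rewrite -lerBrDl ge_min lexx.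
Qed.

(** For v <= t the first terms on the right suffice, for v > t the last one:
    then v^(m-4) <= t^(m-4) because m < 4. *)
Lemma powR_interpolation (m t v : R) : 1 <= m < 4 -> 0 < t -> 0 <= v ->
  v `^ m <= t `^ (m - 1) * v + t `^ (m - 4) * v ^+ 4 /\
  v `^ m <= t `^ m + t `^ (m - 4) * v ^+ 4.
Proof.
move=> /andP[m1 m4] t0 v0.
have tv4 : 0 <= t `^ (m - 4) * v ^+ 4 by rewrite mulr_ge0 ?powR_ge0 ?exprn_ge0.
have tv1 : 0 <= t `^ (m - 1) * v by rewrite mulr_ge0 ?powR_ge0.
have tm := powR_ge0 t m.
have [vt|tv] := leP v t.
  have h2 : v `^ m <= t `^ m by apply: ge0_ler_powR; rewrite ?nnegrE//; lra.
  split; last by rewrite (le_trans h2)// lerDl.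
  apply: le_trans (_ : t `^ (m - 1) * v <= _); last by rewrite lerDl.
  have [->|vn0] := eqVneq v 0; first by rewrite mulr0 powR0// gt_eqF//; lra.
  have -> : v `^ m = v `^ (m - 1) * v.
    by rewrite -[X in _ * X](powRr1 v0) -powRD ?subrK// vn0 implybT.
  by rewrite ler_wpM2r//; apply: ge0_ler_powR; rewrite ?nnegrE//; lra.
have vpos : 0 < v by exact: lt_trans tv.
have h : v `^ m <= t `^ (m - 4) * v ^+ 4.
  have -> : v `^ m = v `^ (m - 4) * v ^+ 4.
    by rewrite -powR_mulrn// -powRD ?subrK// (gt_eqF vpos) implybT.
  rewrite ler_wpM2r ?exprn_ge0// -(opprB 4 m) !powRN lef_pV2 ?posrE ?powR_gt0//.
  by apply: ge0_ler_powR; rewrite ?nnegrE//; lra.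
by split; rewrite (le_trans h)// lerDr.
Qed.

Section interpolation.
Variables (m : R) (f : R * R -> R).
Hypotheses (hm : 1 <= m < 4) (mf : measurable_fun [set: mR * mR] f).

Let mfm : measurable_fun [set: mR * mR] (fun p => (`|f p| `^ m)%:E).
Proof.
apply/measurable_EFinP; apply: (measurableT_comp (measurable_powR _)).
exact: measurableT_comp.
Qed.

Let mfa : measurable_fun [set: mR * mR] (fun p => `|f p|%:E).
Proof. by apply/measurable_EFinP; exact: measurableT_comp. Qed.

Let f40 p : (0 <= (f p ^+ 4)%:E)%E.
Proof. by rewrite lee_fin exprn_even_ge0. Qed.

Let f4E p : `|f p| ^+ 4 = f p ^+ 4.
Proof. by rewrite -normrX ger0_norm// exprn_even_ge0. Qed.

Lemma integral_interpolation (t : R) : 0 < t ->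
  (\int[muO R]_p (`|f p| `^ m)%:E <=
   (t `^ (m - 1))%:E * \int[muO R]_p `|f p|%:E +
   (t `^ (m - 4))%:E * \int[muO R]_p (f p ^+ 4)%:E)%E.
Proof.
move=> t0; have m4 := measurable_EFinX 4 mf.
have t10 : (0 <= (t `^ (m - 1))%:E)%E by rewrite lee_fin powR_ge0.
have t40 : (0 <= (t `^ (m - 4))%:E)%E by rewrite lee_fin powR_ge0.
have fa0 p : (0 <= `|f p|%:E)%E by rewrite lee_fin.
rewrite -(ge0_integralZl (muO R) measurableT mfa (fun p _ => fa0 p) t10).
rewrite -(ge0_integralZl (muO R) measurableT m4 (fun p _ => f40 p) t40).
rewrite -(ge0_integralD (muO R) measurableT
  (fun p _ => mule_ge0 t10 (fa0 p)) (measurable_funeM _ mfa)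
  (fun p _ => mule_ge0 t40 (f40 p)) (measurable_funeM _ m4)).
apply: ge0_le_integral => //.
- by apply: emeasurable_funD; exact: measurable_funeM.
- move=> p _; rewrite -!EFinM -EFinD lee_fin -f4E.
  exact: (powR_interpolation hm t0 (normr_ge0 _)).1.
Qed.

Lemma integral_powR_le (t : R) : 0 < t ->
  (\int[muO R]_p (f p ^+ 4)%:E <= (t ^+ 4)%:E)%E ->
  (\int[muO R]_p (`|f p| `^ m)%:E <= (2 * t `^ m)%:E)%E.
Proof.
move=> t0 ft; have m4 := measurable_EFinX 4 mf.
have t40 : (0 <= (t `^ (m - 4))%:E)%E by rewrite lee_fin powR_ge0.
apply: (@le_trans _ _ ((t `^ m)%:E + (t `^ (m - 4))%:E * \int[muO R]_p (f p ^+ 4)%:E)%E).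
  rewrite -(ge0_integralZl (muO R) measurableT m4 (fun p _ => f40 p) t40).
  have -> : ((t `^ m)%:E = \int[muO R]_p (t `^ m)%:E)%E.
    by rewrite integral_cst// muO_setT mule1.
  have tm0 : (0 <= (t `^ m)%:E)%E by rewrite lee_fin powR_ge0.
  rewrite -(ge0_integralD (muO R) measurableT
    (fun p _ => tm0) (measurable_cst _)
    (fun p _ => mule_ge0 t40 (f40 p)) (measurable_funeM _ m4)).
  apply: ge0_le_integral => //.
  - by apply: emeasurable_funD => //; exact: measurable_funeM.
  - move=> p _; rewrite -!EFinM -EFinD lee_fin -f4E.
    exact: (powR_interpolation hm t0 (normr_ge0 _)).2.
apply: le_trans (leeD2l _ (lee_wpmul2l t40 ft)) _.
rewrite -EFinM -EFinD lee_fin -(powR_mulrn 4 (ltW t0)) -powRD; last first.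
  by rewrite (gt_eqF t0) implybT.
by rewrite subrK mulr_natl mulr2n.
Qed.

Lemma Lnorm_le_L4 (t : R) : 0 < t ->
  (\int[muO R]_p (f p ^+ 4)%:E <= (t ^+ 4)%:E)%E ->
  ('N[muO R]_(m%:E)[EFin \o f] <= (2 * t)%:E)%E.
Proof.
move=> t0 ft; have /andP[m1 _] := hm.
rewrite Lnorm_le; [|lra|by rewrite mulr_ge0// ltW].
apply: le_trans (integral_powR_le t0 ft) _.
rewrite lee_fin (powRM _ (ler0n _ 2) (ltW t0)) ler_wpM2r ?powR_ge0//.
by rewrite -[leLHS]powRr1// ler_powR// ler1n.
Qed.

End interpolation.

(** The bound holds with H1norm u + e in place of H1norm u for each e > 0; the
    slack also covers the case where the norm is 0. *)
Lemma H10_Lm (a1 a2 m : R) (u : H1 a1 a2) :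
  0 < a1 < 2^-1 -> 0 < a2 < 2^-1 -> 1 <= m < 4 -> @H10 R a1 a2 u ->
  (u : R * R -> R) \in Lfun (muO R) m%:E /\
  ('N[muO R]_(m%:E)[EFin \o u] <= (2 * H1norm u)%:E)%E.
Proof.
move=> ha1 ha2 hm Hu; have meas_u := Lfun_measurable (H1fun_L2 u).
have K0 : 0 <= H1norm u by exact: sqrtr_ge0.
have H e : 0 < e -> ('N[muO R]_(m%:E)[EFin \o u] <= (2 * (H1norm u + e))%:E)%E.
  move=> e0; apply: (Lnorm_le_L4 hm meas_u); first by rewrite ltr_wpDl.
  by apply: (integral_expr4_H10_le ha1 ha2 Hu); rewrite ltrDl.
split.
  apply: mem_Lfun => //; apply: le_lt_trans (H 1 ltr01) _; exact: ltry.
apply/lee_addgt0Pr => e e0; rewrite -EFinD.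
have -> : 2 * H1norm u + e = 2 * (H1norm u + e / 2) by lra.
by apply: H; rewrite divr_gt0.
Qed.

End embedding.

(** * Compactness *)

Section compactness.
Context {R : realType}.
Local Notation mR := (measurableTypeR R).

(** Interpolation between L^1 and L^4: on a bounded set of L^4, smallness in L^1
    forces smallness in L^m. *)
Lemma Lm_le_of_L1_small (m B e : R) : 1 <= m < 4 -> 0 < B -> 0 < e ->
  exists2 delta : R, 0 < delta & forall f : R * R -> R,
    measurable_fun [set: mR * mR] f ->
    (\int[muO R]_p (f p ^+ 4)%:E <= (B ^+ 4)%:E)%E ->
    (\int[muO R]_p `|f p|%:E <= delta%:E)%E ->
    ('N[muO R]_(m%:E)[EFin \o f] <= e%:E)%E.
Proof.
move=> hm B0 e0; have /andP[m1 m4] := hm.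
have em0 : 0 < e `^ m by exact: powR_gt0.
have B40 : 0 < B ^+ 4 by exact: exprn_gt0.
(* t solves t^(m-4) B^4 = e^m / 2, so each term contributes half of e^m. *)
pose c := 2 * B ^+ 4 / e `^ m.
have c0 : 0 < c by rewrite divr_gt0 ?mulr_gt0.
pose t := c `^ (4 - m)^-1.
have t0 : 0 < t by exact: powR_gt0.
have tc : t `^ (m - 4) = c^-1.
  rewrite -(opprB 4 m) powRN -powRrM mulVf ?powRr1 ?ltW//.
  by rewrite gt_eqF// subr_gt0.
have tm0 : 0 < t `^ (m - 1) by exact: powR_gt0.
exists (e `^ m / 2 / t `^ (m - 1)); first by rewrite !divr_gt0.
move=> f mf f4 f1.
rewrite Lnorm_le; [|lra|exact: ltW].
apply: le_trans (integral_interpolation hm mf t0) _.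
apply: le_trans (leeD (lee_wpmul2l _ f1) (lee_wpmul2l _ f4)) _.
- by rewrite lee_fin ltW.
- by rewrite lee_fin powR_ge0.
rewrite -!EFinM -EFinD lee_fin tc /c le_eqVlt; apply/orP; left; apply/eqP.
by field; rewrite !gt_eqF.
Qed.

(** Replace u n by a test function phi n at L^1 distance 1/(n+1).  For N large,
    the gradient term in the distance of phi n and phi k is at most e/4, and
    the N^2 integrals over cells converge along U. *)
Lemma H10_ultra_cauchy (a1 a2 t : R) (u : nat -> H1 a1 a2) (U : set_system nat) :
  0 < a1 < 2^-1 -> 0 < a2 < 2^-1 ->
  (forall n, @H10 R a1 a2 (u n)) -> (forall n, H1norm (u n) <= t) ->
  UltraFilter U -> \oo `<=` U -> forall e : R, 0 < e ->
  exists2 S, U S & forall n k, S n -> S k ->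
    (\int[muO R]_p `|u n p - u k p|%:E <= e%:E)%E.
Proof.
move=> ha1 ha2 uH ut UU subU e e0.
have [a10 _] := andP ha1; have [a20 _] := andP ha2.
have UF : ProperFilter U by exact: ultra_proper.
have t0 : 0 <= t by apply: le_trans (ut 0%N); exact: sqrtr_ge0.
pose M := (t + 1) ^+ 2.
have inv1 (n : nat) : n.+1%:R^-1 <= 1 :> R by rewrite invf_le1 ?ltr0n// ler1n.
have /choice[phi phiP] : forall n, exists phi, exists D1 D2 : R * R -> R,
  [/\ c1_on phi D1 D2,
      (\int[muO R]_p `|u n p - phi p|%:E <= (n.+1%:R^-1)%:E)%E,
      (\int[muO R]_p ((weight_y a1 p * D1 p) ^+ 2)%:E <= M%:E)%E &
      (\int[muO R]_p ((weight_x a2 p * D2 p) ^+ 2)%:E <= M%:E)%E].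
  move=> n; have n0 : 0 < n.+1%:R^-1 :> R by rewrite invr_gt0 ltr0n.
  have [phi [D1 [D2 [c1 h0 h1 h2]]]] := H10_approx a10 a20 n0 (uH n).
  have hM : (H1norm (u n) + n.+1%:R^-1) ^+ 2 <= M.
    have K0 : 0 <= H1norm (u n) by exact: sqrtr_ge0.
    apply: lerXn2r; [|by rewrite nnegrE addr_ge0|exact: lerD].
    by rewrite nnegrE addr_ge0// ltW.
  exists phi, D1, D2; split=> //.
  - by apply: le_trans h1 _; rewrite lee_fin.
  - by apply: le_trans h2 _; rewrite lee_fin.
have meas_u n := Lfun_measurable (H1fun_L2 (u n)).
have mphi n : measurable_fun [set: mR * mR] (phi n).
  have [D1 [D2 [[[cphi _ _] _ _ _] _ _ _]]] := phiP n.
  exact: continuous_measurable_prod.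
have phi1 n : (\int[muO R]_p `|phi n p|%:E <= (2 * (t + 1))%:E)%E.
  have [D1 [D2 [c1 _ h1 h2]]] := phiP n.
  have t10 : 0 < t + 1 by lra.
  have h4 : (\int[muO R]_p (phi n p ^+ 4)%:E <= ((t + 1) ^+ 4)%:E)%E.
    apply: le_trans (integral_expr4_le_energy ha1 ha2 c1) _.
    apply: le_trans (lee_pmul _ _ h1 h2) _.
    - by apply: integral_ge0 => p _; rewrite lee_fin sqr_ge0.
    - by apply: integral_ge0 => p _; rewrite lee_fin sqr_ge0.
    - by rewrite -EFinM /M -exprD.
  have h14 : (1 : R) < 4 by lra.
  have h11 : 1 <= (1 : R) < 4 by rewrite lexx h14.
  rewrite -(powRr1 (ltW t10)).
  apply: le_trans (integral_powR_le h11 (mphi n) t10 h4).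
  by under [leRHS]eq_integral do rewrite powRr1//.
pose C := 2 * ((1 - 2 * a1)^-1 + M) + 2 * ((1 - 2 * a2)^-1 + M).
have C0 : 0 < C.
  have M0 : 0 <= M by exact: sqr_ge0.
  have : 0 < (1 - 2 * a1)^-1 by rewrite invr_gt0; lra.
  have : 0 < (1 - 2 * a2)^-1 by rewrite invr_gt0; lra.
  by rewrite /C; lra.
have [N N0 NC] : exists2 N : nat, (0 < N)%N & N%:R^-1 * C <= e / 4.
  exists (Num.truncn (C / (e / 4))).+1 => //.
  rewrite mulrC ler_pdivrMr ?ltr0n// mulrC -ler_pdivrMr ?divr_gt0//.
  exact: ltW (truncnS_gt _).
have N2 : 0 < (N%:R * N%:R : R) by rewrite mulr_gt0 ?ltr0n.
(* Two deviations of at most d on each of the N^2 cells add up to e / 4. *)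
pose d := e / 8 / (N%:R * N%:R).
have d0 : 0 < d by rewrite !divr_gt0.
have /choice[c cP] : forall ij : 'I_N * 'I_N, exists c, forall e', 0 < e' ->
    \forall n \near U, `|grid_integral N ij.1 ij.2 (phi n) - c| < e'.
  move=> [i j]; apply: (@ultra_bounded_cvg _ _ _ (2 * (t + 1))) => n.
  have [D1 [D2 [c1 _ _ _]]] := phiP n.
  by rewrite -lee_fin; apply: le_trans (grid_integral_le_L1 i j c1) (phi1 n).
have Ugrid : \forall n \near U, forall ij : 'I_N * 'I_N,
    `|grid_integral N ij.1 ij.2 (phi n) - c ij| < d.
  by apply: filter_forall => ij; exact: cP.
have Un : \forall n \near U, n.+1%:R^-1 <= e / 4 :> R.
  apply: subU; exists (Num.truncn (e / 4)^-1) => // n /= nN.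
  rewrite -[leRHS]invrK lef_pV2 ?posrE ?invr_gt0 ?divr_gt0 ?ltr0n//.
  by apply: le_trans (ltW (truncnS_gt _)) _; rewrite ler_nat.
exists [set n | (forall ij : 'I_N * 'I_N,
    `|grid_integral N ij.1 ij.2 (phi n) - c ij| < d) /\ n.+1%:R^-1 <= e / 4 :> R].
  exact: filterI.
move=> n k [nd n4] [kd k4].
have [D1 [D2 [c1n hn0 hn1 hn2]]] := phiP n.
have [E1 [E2 [c1k hk0 hk1 hk2]]] := phiP k.
apply: le_trans (integral_normB_le3 (muO R) (meas_u n) (mphi n) (mphi k) (meas_u k)) _.
have hmid : (\int[muO R]_p `|phi n p - phi k p|%:E <= (e / 2)%:E)%E.
  apply: le_trans (L1_dist_le_grid ha1 ha2 N0 c1n c1k hn1 hn2 hk1 hk2) _.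
  rewrite lee_fin -/C [leRHS](_ : _ = e / 4 + e / 4); last by lra.
  apply: lerD => //.
  have -> : e / 4 = \sum_(i < N) \sum_(j < N) (d + d).
    rewrite !sumr_const !card_ord -mulrnA -[RHS]mulr_natl natrM /d; field.
    by rewrite pnatr_eq0 -lt0n.
  apply: ler_sum => i _; apply: ler_sum => j _.
  have := nd (i, j); have := kd (i, j) => /= hk hn.
  rewrite -(subrKA (c (i, j))) -[in X in _ + X]opprB.
  exact: le_trans (ler_normB _ _) (lerD (ltW hn) (ltW hk)).
have hn : (\int[muO R]_p `|u n p - phi n p|%:E <= (e / 4)%:E)%E.
  by apply: le_trans hn0 _; rewrite lee_fin.
have hk : (\int[muO R]_p `|u k p - phi k p|%:E <= (e / 4)%:E)%E.
  by apply: le_trans hk0 _; rewrite lee_fin.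
apply: le_trans (leeD (leeD hn hmid) hk) _.
by rewrite -!EFinD lee_fin; lra.
Qed.

End compactness.

Theorem theorem2p9 (R : realType) (a1 a2 : R) (m : R)
    (ha1 : 0 < a1 < 2^-1) (ha2 : 0 < a2 < 2^-1) (hm : 1 <= m < 4) :
  compactly_embedded_in_Lm (@H10 R a1 a2) m.
Proof.
split.
- by move=> u Hu; exact: (H10_Lm ha1 ha2 hm Hu).1.
- by exists 2 => u Hu; exact: (H10_Lm ha1 ha2 hm Hu).2.
move=> u uH [M uM].
pose t := `|M| + 1.
have t0 : 0 < t by rewrite ltr_wpDl.
have ut n : H1norm (u n) < t.
  by apply: le_lt_trans (uM n) _; rewrite ltr_pwDr// ler_norm.
have u4 n : (\int[muO R]_p (u n p ^+ 4)%:E <= (t ^+ 4)%:E)%E.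
  exact: integral_expr4_H10_le ha1 ha2 (uH n) (ut n).
have meas_u n := Lfun_measurable (H1fun_L2 (u n)).
have [s s_incr sD] := @rapid_cauchy_subseq R
  (fun n k => \int[muO R]_p `|u n p - u k p|%:E)%E
  (fun U UU subU => H10_ultra_cauchy ha1 ha2 uH (fun n => ltW (ut n)) UU subU).
have ms k : measurable_fun [set: measurableTypeR R * measurableTypeR R] (u (s k)) :=
  meas_u (s k).
have [l ml u_l] := ae_cvg_rapid_cauchy ms sD.
have l4 : (\int[muO R]_p (l p ^+ 4)%:E <= (t ^+ 4)%:E)%E.
  apply: (@integral_comp_le_ae_limit _ _ _ (muO R) (fun r => r ^+ 4)
    (fun k => u (s k)) l) => //.
  - exact: exprn_continuous.
  - by move=> r; rewrite exprn_even_ge0.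
  - exact: nearW.
exists s, l; split => //.
  apply: mem_Lfun => //.
  exact: le_lt_trans (Lnorm_le_L4 hm ml t0 l4) (ltry _).
have dist := le_rapid_limit_dist ms ml u_l sD.
have small (e : R) : 0 < e -> \forall n \near \oo,
    ('N[muO R]_(m%:E)[EFin \o (fun p => (u (s n) p - l p)%R)] <= e%:E)%E.
  move=> e0; have t20 : 0 < 2 * t by rewrite mulr_gt0.
  have [d d0 dP] := Lm_le_of_L1_small hm t20 e0.
  exists (Num.truncn d^-1) => // n /= nd; apply: dP.
  - exact: measurable_funB.
  - exact: integral_expr4B_le.
  - apply: le_trans (dist n) _; rewrite lee_fin div1r.
    rewrite -[leRHS]invrK lef_pV2 ?posrE ?invr_gt0 ?ltr0n ?expn_gt0//.
    apply: le_trans (ltW (truncnS_gt _)) _; rewrite ler_nat.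
    by apply: leq_trans (ltn_expl n (ltnSn 1)); rewrite ltnS.
apply/fine_cvgP; split.
  apply: filterS (small 1 ltr01) => n h.
  rewrite ge0_fin_numE ?Lnorm_ge0//; exact: le_lt_trans h (ltry _).
apply/cvgrPdist_le => e e0; apply: filterS (small e e0) => n h /=.
rewrite sub0r normrN ger0_norm ?fine_ge0 ?Lnorm_ge0//.
by rewrite -lee_fin fineK// ge0_fin_numE ?Lnorm_ge0//; exact: le_lt_trans h (ltry _).
Qed.
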